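(* There exist a problem $f$ and a distribution $\mu$ with $Q_2(f)=O(n^2)$ and $Q_{SE}^\mu(f)=\Omega(2^{n/8})$. That is, there exist, for each integer $n\ge1$, a set $D_n\subseteq\{0,1\}^{N}$ with $N=n2^n$, a function $f_n:D_n\to\{0,1\}$ and a probability distribution $\mu_n$ on $D_n$ such that, as $n\to\infty$, $$Q_2(f_n)=O(n^2)\qquad\text{and}\qquad Q_{SE}^{\mu_n}(f_n)=\Omega\left(2^{n/8}\right).$$
   Context: Quantum query model. The input $x\in\{0,1\}^N$ is accessed through the unitary $O=O_x$ acting on basis states by $O|i,b,z\rangle=|i,b\oplus x_i,z\rangle$, with $i\in\{1,\dots,N\}$, $b\in\{0,1\}$ and $z$ a workspace of finitely many qubits. A $T$-query quantum algorithm is $A=U_TOU_{T-1}O\cdots U_1OU_0$, with each $U_j$ a fixed unitary independent of $x$; it starts in the all-zero state $|0\dots0\rangle$, and its output is obtained by measuring the rightmost bit of the final state $A|0\dots 0\rangle$. $P_A(x)$ denotes the probability that $A$ outputs $1$ on input $x$ (defined for every $x\in\{0,1\}^N$). For $D\subseteq\{0,1\}^N$ and $f:D\to\{0,1\}$, $Q_2(f)$ is the minimal number of queries $T$ of a quantum algorithm that outputs $f(x)$ with probability at least $\frac23$ for every $x\in D$. For a probability distribution $\mu$ on $D$, an algorithm $A$ is strongly $\frac23$-exact for $f$ with respect to $\mu$ if $\mu(\{x\in D: P_A(x)=f(x)\})\ge\frac23$ and, in addition, $P_A(x)\in\{0,1\}$ for all $x\in\{0,1\}^N$ (including $x\notin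 D$). $Q_{SE}^\mu(f)$ is the minimal number of queries of a strongly $\frac23$-exact algorithm for $f$ with respect to $\mu$. *)

(* Defs.v *)
From mathcomp Require Export all_boot all_order all_algebra spectral.
From mathcomp Require Export complex.
From mathcomp Require Export classical_sets filter reals ereal topology exp.

Set Implicit Arguments.
Unset Strict Implicit.
Unset Printing Implicit Defensive.

Import Order.TTheory GRing.Theory Num.Theory.
Local Open Scope ring_scope.

(* Inputs x in {0,1}^N; the positions 1, ..., N are shifted to 0, ..., N - 1. *)
Definition input (N : nat) : finType := {ffun 'I_N -> bool}.

(* Basis labels (i, b, z), with z a string of w workspace bits. *)
Definition label (N w : nat) : finType := ('I_N * bool * w.-tuple bool)%type.

(* Dimension of the state space. Row and column indices stand for labels
   through enum_val; states are column vectors, operators act on the left. *)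
Definition qdim (N w : nat) : nat := #|{: label N w}|.

Definition query_label N w (x : input N) (l : label N w) : label N w :=
  let: (i, b, z) := l in (i, b (+) x i, z).

(* The label of |0...0>; the first index plays the role of the zero of the
   index register. *)
Definition is_zero_label N w (l : label N w) : bool :=
  let: (i, b, z) := l in [&& i == 0%N :> nat, ~~ b & ~~ has id z].

(* When the workspace is empty, the rightmost bit of (i, b, z) is b. *)
Definition rightmost N w (l : label N w) : bool :=
  let: (i, b, z) := l in last b z.

Definition oracle (R : realType) N w (x : input N) : 'M[R[i]]_(qdim N w) :=
  \matrix_(r, c) (enum_val r == query_label x (enum_val c))%:R.

Definition zero_state (R : realType) N w : 'cV[R[i]]_(qdim N w) :=
  \col_k (is_zero_label (enum_val k))%:R.

(* A T-query algorithm: U_0 is qinit, and U_1, ..., U_T are the entries of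
   qsteps in this order. *)
Record qalg (R : realType) (N T : nat) := QAlg {
  qwork : nat;
  qinit : 'M[R[i]]_(qdim N qwork);
  qsteps : T.-tuple 'M[R[i]]_(qdim N qwork);
  qinit_unitary : qinit \is unitarymx;
  qsteps_unitary : forall j : 'I_T, tnth qsteps j \is unitarymx
}.

(* The operator U_T O U_(T-1) O ... U_1 O U_0. *)
Definition qoperator (R : realType) N T (A : qalg R N T) (x : input N) :
    'M[R[i]]_(qdim N (qwork A)) :=
  foldl (fun M U => U *m oracle R (qwork A) x *m M) (qinit A) (qsteps A).

Definition final_state (R : realType) N T (A : qalg R N T) (x : input N) :
    'cV[R[i]]_(qdim N (qwork A)) :=
  qoperator A x *m zero_state R N (qwork A).

Definition prob_output (R : realType) N T (A : qalg R N T) (x : input N)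
    (b : bool) : R :=
  \sum_(k | rightmost (enum_val k) == b)
    ComplexField.Normc.normc (final_state A x k 0) ^+ 2.

(* P_A(x) *)
Definition accept_prob (R : realType) N T (A : qalg R N T) (x : input N) : R :=
  prob_output A x true.

(* D as a type: elements of D are inputs packed with a membership proof. *)
Notation dom D := {x | x \in D}.

Definition is_distribution (R : realType) N (D : {set input N})
    (mu : dom D -> R) : Prop :=
  (forall x, 0 <= mu x) /\ \sum_x mu x = 1.

Definition bounded_error (R : realType) N (D : {set input N})
    (f : dom D -> bool) T (A : qalg R N T) : Prop :=
  forall x : dom D, 2 / 3 <= prob_output A (val x) (f x).

Definition strongly_exact (R : realType) N (D : {set input N})
    (f : dom D -> bool) (mu : dom D -> R) T (A : qalg R N T) : Prop :=
  2 / 3 <= \sum_(x : dom D | accept_prob A (val x) == (f x)%:R) mu x /\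
  forall x : input N, accept_prob A x = 0 \/ accept_prob A x = 1.

(* The least T satisfying P: the infimum of a nonempty set of naturals is
   attained. It is +oo if no T satisfies P. *)
Definition least_queries (R : realType) (P : nat -> Prop) : \bar R :=
  ereal_inf [set ((T%:R : R)%:E)%E | T in [set T | P T]]%classic.

Definition Q2 (R : realType) N (D : {set input N}) (f : dom D -> bool) :
    \bar R :=
  least_queries R (fun T => exists A : qalg R N T, bounded_error f A).

Definition QSE (R : realType) N (D : {set input N}) (f : dom D -> bool)
    (mu : dom D -> R) : \bar R :=
  least_queries R (fun T => exists A : qalg R N T, strongly_exact f mu A).

(* Main.v *)
(* A "one-bit Simon problem". For F : {0,1}^m -> {0,1} consider the phase state
   of F. Measuring its Fourier transform returns y with probability fhat F y ^ 2;
   if F has the period s this is supported on the y orthogonal to s, while for a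
   typical F each s is orthogonal to only about half of the mass. So O(m) Fourier
   samples, one query each, tell periodic functions (some period in a fixed set
   S of 2^n strings) from random ones; f asks for this distinction on the inputs
   where the sampling algorithm is reliable.
   Conversely, a strongly exact T-query algorithm makes P_A a 0/1-valued
   polynomial of degree 2T. Such a polynomial has block sensitivity O(T^2) (Markov's
   inequality at the endpoint 0), and repeatedly querying a hitting set of its
   monomials of top degree determines it after O(T^4) queries (Nisan and
   Smolensky). On a random F these queries meet no pair x, x + s unless
   O(T^8) >= |S|, and then F can be exchanged for an s-periodic function that
   agrees with it on all queried positions. Hence T >= 2^(n/8) / 4. *)

Require Import Defs.
From mathcomp Require Import boolp fintype finset perm.
From mathcomp Require Import qpoly ring lra zify.

Set Implicit Arguments.
Unset Strict Implicit.
Unset Printing Implicit Defensive.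

Import Order.TTheory GRing.Theory Num.Theory.
Local Open Scope ring_scope.

(** * Multilinear polynomials on the cube *)

Definition mono N (S : {set 'I_N}) (x : input N) : bool :=
  [forall i, (i \in S) ==> x i].

(** On the cube x_i^2 = x_i, so every polynomial agrees there with a multilinear one of no larger
    degree; monomials are therefore indexed by sets. *)
Definition deg_le (K : comNzRingType) N (d : nat) (h : input N -> K) : Prop :=
  exists2 c : {set 'I_N} -> K, (forall S, c S != 0 -> (#|S| <= d)%N)
    & forall x, h x = \sum_S c S * (mono S x)%:R.

Section Degree.
Variables (K : comNzRingType) (N : nat).
Implicit Types (h : input N -> K) (S : {set 'I_N}).

Lemma mono0 (x : input N) : mono set0 x.
Proof. by apply/forallP => i; rewrite inE. Qed.

Lemma mono1 i (x : input N) : mono [set i] x = x i.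
Proof.
apply/forallP/idP => [/(_ i)|xi j]; first by rewrite inE eqxx.
by rewrite inE; apply/implyP => /eqP->.
Qed.

Lemma monoU S1 S2 (x : input N) : mono (S1 :|: S2) x = mono S1 x && mono S2 x.
Proof.
apply/forallP/andP => [H|[/forallP H1 /forallP H2] i].
  split; apply/forallP => i; apply/implyP => Hi; apply: (implyP (H i));
  by rewrite inE Hi ?orbT.
by rewrite inE; apply/implyP => /orP[]; [apply/implyP: (H1 i)|apply/implyP: (H2 i)].
Qed.

Lemma deg_ext d h1 h2 : h1 =1 h2 -> deg_le d h1 -> deg_le d h2.
Proof. by move=> e [c Hc H]; exists c => // x; rewrite -e. Qed.

Lemma deg_weaken d1 d2 h : (d1 <= d2)%N -> deg_le d1 h -> deg_le d2 h.
Proof. by move=> le [c Hc H]; exists c => // S /Hc /leq_trans; apply. Qed.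

Lemma deg_mono S : deg_le #|S| (fun x => (mono S x)%:R : K).
Proof.
exists (fun U => (U == S)%:R) => [U|x].
  by case: (U =P S) => [->|]; rewrite ?eqxx.
rewrite (bigD1 S) //= eqxx mul1r big1 ?addr0 // => U /negPf->.
by rewrite mul0r.
Qed.

Lemma deg_zero d : deg_le d (fun _ : input N => 0 : K).
Proof.
exists (fun _ => 0) => [S|x]; first by rewrite eqxx.
by rewrite big1 // => S _; rewrite mul0r.
Qed.

Lemma deg_add d h1 h2 :
  deg_le d h1 -> deg_le d h2 -> deg_le d (fun x => h1 x + h2 x).
Proof.
move=> [c1 H1 E1] [c2 H2 E2]; exists (fun S => c1 S + c2 S) => [S|x].
  apply: contraNT; rewrite -ltnNge => lt.
  have z c (H : forall S, c S != 0 -> (#|S| <= d)%N) : c S = 0 :> K.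
    by apply: contraTeq lt => /H; rewrite -leqNgt.
  by rewrite !z ?addr0.
by rewrite E1 E2 -big_split; apply: eq_bigr => S _; rewrite mulrDl.
Qed.

Lemma deg_scale d (a : K) h : deg_le d h -> deg_le d (fun x => a * h x).
Proof.
move=> [c H E]; exists (fun S => a * c S) => [S Hn|x].
  by apply: H; apply: contraNneq Hn => ->; rewrite mulr0.
by rewrite E mulr_sumr; apply: eq_bigr => S _; rewrite mulrA.
Qed.

Lemma deg_sum (I : Type) (r : seq I) (P : pred I) d (h : I -> input N -> K) :
  (forall i, P i -> deg_le d (h i)) ->
  deg_le d (fun x => \sum_(i <- r | P i) h i x).
Proof.
move=> H; elim: r => [|i r IH].
  by apply: deg_ext (deg_zero d) => x; rewrite big_nil.
case Pi: (P i).
  by apply: deg_ext (deg_add (H i Pi) IH) => x; rewrite big_cons Pi.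
by apply: deg_ext IH => x; rewrite big_cons Pi.
Qed.

Lemma deg_mul d1 d2 h1 h2 :
  deg_le d1 h1 -> deg_le d2 h2 -> deg_le (d1 + d2) (fun x => h1 x * h2 x).
Proof.
move=> [c1 H1 E1] [c2 H2 E2].
apply: (@deg_ext _ (fun x => \sum_S1 \sum_S2 c1 S1 * c2 S2 * (mono (S1 :|: S2) x)%:R)).
  move=> x; rewrite E1 E2 mulr_suml; apply: eq_bigr => S1 _.
  rewrite mulr_sumr; apply: eq_bigr => S2 _.
  by rewrite monoU mulrACA -natrM mulnb.
apply: deg_sum => S1 _; apply: deg_sum => S2 _.
have [->|n1] := eqVneq (c1 S1) 0.
  by apply: deg_ext (deg_zero _) => x; rewrite !mul0r.
have [->|n2] := eqVneq (c2 S2) 0.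
  by apply: deg_ext (deg_zero _) => x; rewrite mulr0 mul0r.
apply: deg_scale; apply: deg_weaken (deg_mono _).
by rewrite cardsU (leq_trans (leq_subr _ _)) // leq_add ?H1 ?H2.
Qed.

Lemma deg_const d (a : K) : deg_le d (fun _ : input N => a).
Proof.
apply: (@deg_ext _ (fun x => a * (mono set0 x)%:R)) => [x|].
  by rewrite mono0 mulr1.
by apply/deg_scale/(deg_weaken _ (deg_mono _)); rewrite cards0.
Qed.

Lemma deg_var i : deg_le 1 (fun x : input N => (x i)%:R : K).
Proof.
apply: (@deg_ext _ (fun x => (mono [set i] x)%:R)) => [x|]; first by rewrite mono1.
by apply: deg_weaken (deg_mono _); rewrite cards1.
Qed.

End Degree.

(** Each coordinate gets its own degree bound [e i], so that a coordinate fixed to a constant can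
    count 0 and a free one 1. *)
Lemma deg_comp_mono (K : comNzRingType) N M (s : input M -> input N)
    (e : 'I_N -> nat) (S : {set 'I_N}) :
  (forall i, deg_le (e i) (fun y => (s y i)%:R : K)) ->
  deg_le (\sum_(i in S) e i) (fun y => (mono S (s y))%:R : K).
Proof.
move=> H.
have monoE y : (mono S (s y))%:R = \prod_(i in S) (s y i)%:R :> K.
  have [/forallP m|] := boolP (mono S (s y)).
    by rewrite big1 // => i iS; have /implyP/(_ iS)-> := m i.
  case/forallPn => i; rewrite negb_imply => /andP[iS /negPf ni].
  by rewrite (bigD1 i) //= ni mul0r.
apply: (@deg_ext _ _ _ (fun y => \prod_(i in S) (s y i)%:R)) => [y|]; first by rewrite monoE.
suff G r : deg_le (\sum_(i <- r) e i) (fun y => \prod_(i <- r) (s y i)%:R : K).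
  by rewrite -big_filter; apply: deg_ext (G _) => y; rewrite big_filter.
elim: r => [|i r IH].
  by apply: deg_ext (deg_const _ _ 1) => y; rewrite big_nil.
by rewrite big_cons; apply: deg_ext (deg_mul (H i) IH) => y; rewrite big_cons.
Qed.

Lemma deg_comp (K : comNzRingType) N M (s : input M -> input N) d (h : input N -> K) :
  (forall i, deg_le 1 (fun y => (s y i)%:R : K)) ->
  deg_le d h -> deg_le d (fun y => h (s y)).
Proof.
move=> H [c Hc E].
apply: (@deg_ext _ _ _ (fun y => \sum_S c S * (mono S (s y))%:R)) => [y|].
  by rewrite E.
apply: deg_sum => S _; have [->|n] := eqVneq (c S) 0.
  by apply: deg_ext (deg_zero _ _ _) => y; rewrite mul0r.
apply/deg_scale/(deg_weaken (Hc S n)); rewrite -sum1_card.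
exact: deg_comp_mono.
Qed.

(** * Markov inequality at an endpoint *)

(** Passing from j to j + 1 multiplies the right side by (d + j + 1) / (d - j), which is at least
    1. *)
Lemma fact_sq_le d j : (j <= d)%N -> (d`! * d`! <= (d - j)`! * (d + j)`!)%N.
Proof.
elim: j => [|j IH] lt; first by rewrite subn0 addn0.
apply: leq_trans (IH (ltnW lt)) _.
have -> : (d - j = (d - j.+1).+1)%N by lia.
rewrite addnS !factS mulnCA -mulnA leq_mul2r; apply/orP; right; lia.
Qed.

(** Factor each difference of squares; the differences and the sums both run through consecutive
    integers and give quotients of factorials. The next lemma does the same above the node. *)
Lemma prod_sq_low (R : realFieldType) (j k : nat) : (k <= j)%N ->
  \prod_(0 <= i < k) (j.+1%:R ^+ 2 - i.+1%:R ^+ 2 : R) * (j - k)`!%:R * j.+1`!%:R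
  = j`!%:R * (j.+1 + k)`!%:R.
Proof.
elim: k => [|k IH] lt; first by rewrite big_geq // subn0 addn0 mul1r mulrC mulrC.
rewrite big_nat_recr //= addnS (factS (j.+1 + k)) natrM [RHS]mulrCA -(IH (ltnW lt)).
have -> : (j - k = (j - k.+1).+1)%N by lia.
rewrite (factS (j - k.+1)) natrM.
have -> : (j.+1 + k).+1%:R = j.+1%:R + k.+1%:R :> R by rewrite -natrD addnS.
have -> : (j - k.+1).+1%:R = j.+1%:R - k.+1%:R :> R.
  by rewrite -natrB; [congr (_%:R); lia|lia].
ring.
Qed.

Lemma prod_sq_high (R : realFieldType) (j k : nat) :
  \prod_(j.+1 <= i < j.+1 + k) (i.+1%:R ^+ 2 - j.+1%:R ^+ 2 : R) * (j.+1 + j.+1)`!%:R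
  = k`!%:R * (j.+1 + j.+1 + k)`!%:R.
Proof.
elim: k => [|k IH]; first by rewrite big_geq ?addn0 // !mul1r.
rewrite addnS big_nat_recr /=; last by lia.
rewrite mulrAC IH [k.+1`!]factS [in RHS]addnS [(_ + k).+1`!]factS !natrM.
have -> : (j.+1 + k).+1%:R = j.+1%:R + k.+1%:R :> R by rewrite -natrD addnS.
have -> : (j.+1 + j.+1 + k).+1%:R = j.+1%:R + j.+1%:R + k.+1%:R :> R.
  by rewrite -!natrD; congr (_%:R); lia.
ring.
Qed.

Lemma prod_sq (R : realFieldType) (d : nat) :
  \prod_(0 <= i < d) (i.+1%:R ^+ 2 : R) = d`!%:R ^+ 2.
Proof.
elim: d => [|d IH]; first by rewrite big_geq // expr1n.
by rewrite big_nat_recr //= IH factS natrM exprMn mulrC.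
Qed.

(* The product is 2 (d!)^2 / ((d - j - 1)! (d + j + 1)!) in absolute value. *)
Lemma lagrange_sq_le2 (R : realFieldType) d (j : 'I_d) :
  `| \prod_(i < d | i != j) (i.+1%:R ^+ 2 / (i.+1%:R ^+ 2 - j.+1%:R ^+ 2)) : R | <= 2.
Proof.
have jd := ltn_ord j.
rewrite prodf_div normrM normfV.
have num : `|\prod_(i < d | i != j) (i.+1%:R ^+ 2 : R)| * j.+1%:R ^+ 2 = d`!%:R ^+ 2.
  rewrite ger0_norm; last by apply: prodr_ge0 => i _; rewrite exprn_ge0.
  by rewrite -prod_sq big_mkord [in RHS](bigD1 j) //= mulrC.
have den : `|\prod_(i < d | i != j) (i.+1%:R ^+ 2 - j.+1%:R ^+ 2 : R)| * (2 * j.+1%:R ^+ 2)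
    = (d - j.+1)`!%:R * (d + j.+1)`!%:R.
  rewrite normr_prod -(big_mkord (fun i => i != j :> nat)
    (fun i => `|i.+1%:R ^+ 2 - j.+1%:R ^+ 2 : R|)).
  (* Split at the omitted node: all differences below it are negative and all above it positive, so
     the absolute values can be resolved. *)
  rewrite (big_cat_nat (n := j)) //=; last by lia.
  rewrite [X in _ * X * _](big_ltn_cond) //= eqxx /=.
  have lowE : \prod_(0 <= i < j | i != j :> nat) `|i.+1%:R ^+ 2 - j.+1%:R ^+ 2 : R| =
     \prod_(0 <= i < j) (j.+1%:R ^+ 2 - i.+1%:R ^+ 2 : R).
    rewrite big_nat_cond [RHS]big_nat_cond.
    apply: eq_big => [i|i]; first by case: ltngtP => //=; lia.
    move=> /andP[/andP[_ ij] _]; rewrite distrC ger0_norm // subr_ge0.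
    by rewrite ler_sqr ?nnegrE // ler_nat; lia.
  have highE : \prod_(j.+1 <= i < d | i != j :> nat) `|i.+1%:R ^+ 2 - j.+1%:R ^+ 2 : R| =
     \prod_(j.+1 <= i < d) (i.+1%:R ^+ 2 - j.+1%:R ^+ 2 : R).
    rewrite big_nat_cond [RHS]big_nat_cond.
    apply: eq_big => [i|i]; first by case: ltngtP => //=; lia.
    move=> /andP[/andP[ij _] _]; rewrite ger0_norm // subr_ge0.
    by rewrite ler_sqr ?nnegrE // ler_nat; lia.
  rewrite lowE highE.
  have L := prod_sq_low R (leqnn j); rewrite subnn mulr1 in L.
  have H := prod_sq_high R j (d - j.+1).
  have e1 : (j.+1 + (d - j.+1) = d)%N by lia.
  have e2 : (j.+1 + j.+1 + (d - j.+1) = d + j.+1)%N by lia.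
  rewrite e1 e2 in H; rewrite -H.
  have e3 : (j.+1 + j.+1 = (j.+1 + j).+1)%N by lia.
  rewrite e3 factS natrM -e3.
  have f0 : j`!%:R != 0 :> R by rewrite pnatr_eq0 -lt0n fact_gt0.
  have -> : (j.+1 + j)`!%:R = \prod_(0 <= i < j) (j.+1%:R ^+ 2 - i.+1%:R ^+ 2 : R) * j.+1%:R.
    apply: (mulfI f0); rewrite -L factS natrM; ring.
  rewrite natrD; ring.
have den0 : 0 < (d - j.+1)`!%:R * (d + j.+1)`!%:R :> R.
  by rewrite -natrM ltr0n muln_gt0 !fact_gt0.
have Dgt0 : 0 < `|\prod_(i < d | i != j) (i.+1%:R ^+ 2 - j.+1%:R ^+ 2 : R)|.
  rewrite normr_gt0; apply/eqP => D0; move: den0.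
  by rewrite -den D0 normr0 mul0r ltxx.
rewrite ler_pdivrMr //.
have j0 : 0 < j.+1%:R ^+ 2 :> R by rewrite exprn_gt0 // ltr0n.
rewrite -(ler_pM2r j0) num -mulrA mulrCA den expr2 -!natrM ler_nat.
exact: fact_sq_le.
Qed.

Lemma sum_inv_sq_le2 (R : realFieldType) d :
  \sum_(j < d) (j.+1%:R ^+ 2)^-1 <= 2 :> R.
Proof.
case: d => [|d]; first by rewrite big_ord0.
(* The sharper bound 2 - 1/(d+1) telescopes, as 1/(d+2)^2 <= 1/(d+1) - 1/(d+2). *)
suff: \sum_(j < d.+1) (j.+1%:R ^+ 2)^-1 <= 2 - d.+1%:R^-1 :> R.
  by move=> /le_trans; apply; rewrite gerBl invr_ge0.
elim: d => [|d IH]; first by rewrite big_ord1 expr1n invr1; lra.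
rewrite big_ord_recr /=; apply: le_trans (lerD IH (lexx _)) _.
have a0 : 0 < d.+1%:R :> R by rewrite ltr0n.
have b0 : 0 < d.+2%:R :> R by rewrite ltr0n.
have step : (d.+2%:R ^+ 2)^-1 <= d.+1%:R^-1 - d.+2%:R^-1 :> R.
  have -> : d.+1%:R^-1 - d.+2%:R^-1 = (d.+1%:R * d.+2%:R)^-1 :> R.
    move: a0 b0; rewrite -[d.+2%:R]natr1; set u := d.+1%:R => a0 b0.
    by field; rewrite !gt_eqF.
  by rewrite lef_pV2 ?posrE ?mulr_gt0 ?exprn_gt0 // expr2 ler_pM2r // ler_nat.
by apply: le_trans (lerD (lexx _) step) _; rewrite addrA subrK.
Qed.

Lemma lagrange_at0 (R : fieldType) d (x : nat -> R) (p : {poly R}) :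
  injective x -> (size p <= d)%N ->
  p.[0] = \sum_(j < d) p.[x j] * \prod_(i < d | i != j) (x i / (x i - x j)).
Proof.
case: d => [|d] xI sp.
  by move: sp; rewrite leqn0 size_poly_eq0 => /eqP->; rewrite big_ord0 horner0.
rewrite [in LHS](lagrange_gen _ xI sp) // horner_sum; apply: eq_bigr => j _.
rewrite hornerM hornerC lagrangeE // hornerM hornerC; congr (_ * _).
rewrite !horner_prod -prodfV -big_split /=; apply: eq_bigr => i _.
by rewrite !hornerXsubC sub0r -opprB invrN mulrNN mulrC.
Qed.

(* Lagrange interpolation of (p - p(0)) / X at the nodes (j / d)^2, 1 <= j <= d,
   where it is bounded by (d / j)^2. *)
Lemma markov_endpoint (R : realFieldType) d (p : {poly R}) :
  (size p <= d.+1)%N -> (forall x, 0 <= x <= 1 -> 0 <= p.[x] <= 1) ->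
  `|p`_1| <= 4 * d%:R ^+ 2.
Proof.
move=> sp bp.
have [d0|d0] := posnP d.
  by rewrite d0 in sp *; rewrite nth_default // normr0 mulr_ge0 // exprn_ge0.
pose q := drop_poly 1 p.
have pE x : p.[x] = p.[0] + x * q.[x].
  rewrite -[in LHS](poly_take_drop 1 p) hornerD hornerM hornerXn expr1 -/q mulrC.
  congr (_ + _); rewrite -[in RHS](poly_take_drop 1 p) hornerD hornerM hornerXn.
  rewrite expr1 mulr0 addr0.
  have [c ->] : exists c, take_poly 1 p = c%:P.
    by eexists; apply/size1_polyC/size_take_poly.
  by rewrite !hornerC.
have q0 : q.[0] = p`_1 by rewrite horner_coef0 coef_drop_poly.
pose x (j : nat) : R := j.+1%:R ^+ 2 / d%:R ^+ 2.
have dR : 0 < d%:R :> R by rewrite ltr0n.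
have xI : injective x.
  move=> i j /(mulIf _); rewrite invr_eq0 expf_eq0 /= gt_eqF // => /(_ isT) /eqP.
  by rewrite eqrXn2 // eqr_nat => /eqP[].
have sq : (size q <= d)%N by rewrite size_drop_poly; lia.
rewrite -q0 (lagrange_at0 xI sq).
apply: le_trans (ler_norm_sum _ _ _) _.
(* The factor 2 is the bound on the Lagrange weights; the sum of inverse squares supplies the other
   2 of the constant 4. *)
apply: (@le_trans _ _ (\sum_(j < d) (2 * d%:R ^+ 2) * (j.+1%:R ^+ 2)^-1)); last first.
  rewrite -mulr_sumr.
  apply: le_trans (ler_wpM2l _ (sum_inv_sq_le2 R d)) _; first by rewrite mulr_ge0 // exprn_ge0.
  lra.
apply: ler_sum => j _; rewrite normrM.
(* The weights are homogeneous of degree 0 in the nodes, so the scaling by 1/d^2 cancels. *)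
have -> : \prod_(i < d | i != j) (x i / (x i - x j)) =
   \prod_(i < d | i != j) (i.+1%:R ^+ 2 / (i.+1%:R ^+ 2 - j.+1%:R ^+ 2)).
  apply: eq_bigr => i nij; rewrite /x -mulrBl.
  have : (d%:R ^+ 2)^-1 != 0 :> R by rewrite invr_eq0 expf_eq0 /= gt_eqF.
  move: (d%:R ^+ 2)^-1 => v v0.
  by rewrite invfM mulrACA mulfV ?mulr1.
have x0 : 0 < x j by rewrite divr_gt0 // exprn_gt0 // ltr0n.
have x1 : x j <= 1.
  by rewrite ler_pdivrMr ?exprn_gt0 // mul1r ler_sqr ?nnegrE // ler_nat ltn_ord.
have qb : `|q.[x j]| <= (x j)^-1.
  rewrite -[(x j)^-1]mul1r ler_pdivlMr // -[X in _ * X](gtr0_norm x0) -normrM.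
  have -> : q.[x j] * x j = p.[x j] - p.[0] by rewrite [p.[x j]]pE; ring.
  have /andP[a1 a2] := bp (x j) (introT andP (conj (ltW x0) x1)).
  have /andP[b1 b2] := bp 0 (introT andP (conj (lexx 0) ler01)).
  by rewrite ler_norml; apply/andP; split; lra.
apply: le_trans (ler_pM _ _ qb (lagrange_sq_le2 R j)) _ => //.
by rewrite /x invf_div mulrC mulrA.
Qed.

(** * Low-degree Boolean functions are determined by few queries *)

Definition ind N (B : {set 'I_N}) : input N := [ffun i => i \in B].

Lemma mono_ind N (S B : {set 'I_N}) : mono S (ind B) = (S \subset B).
Proof.
apply/forallP/fintype.subsetP => [H i iS|H i]; first by have := H i; rewrite iS ffunE.
by rewrite ffunE; apply/implyP/H.
Qed.

Section Boolean.
Variable R : realFieldType.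

(** Under independent bits of bias p the expectation factors over the coordinates: those in [S]
    contribute p, the others 1. *)
Lemma sum_biased_mono N (p : R) (S : {set 'I_N}) :
  \sum_(x : input N) (\prod_i (if x i then p else 1 - p)) * (mono S x)%:R = p ^+ #|S|.
Proof.
transitivity (\sum_(x : input N) \prod_i
    ((if x i then p else 1 - p) * ((i \in S) ==> x i)%:R)).
  apply: eq_bigr => x _; rewrite big_split /=; congr (_ * _).
  have [/forallP m|/forallPn[i /negPf ni]] := boolP (mono S x).
    by rewrite big1 // => i _; rewrite (m i).
  by rewrite (bigD1 i) //= ni mul0r.
rewrite -(bigA_distr_bigA (fun i b => (if b then p else 1 - p) * ((i \in S) ==> b)%:R)) /=.
rewrite -(@prodr_const _ _ (mem S)) [RHS]big_mkcond /=; apply: eq_bigr => i _.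
by rewrite big_bool /=; case: (i \in S); rewrite /= ?mulr1 ?mulr0 ?addr0 // addrC subrK.
Qed.

(* For independent coordinates that are 1 with probability p, the expectation of
   h is a polynomial in p with values in [0,1] on [0,1] and slope +-N at 0. *)
Lemma sensitivity_le N d (h : input N -> bool) :
  deg_le d (fun x => (h x)%:R : R) ->
  (forall i, h (ind [set i]) != h (ind set0)) -> (N <= 4 * d ^ 2)%N.
Proof.
move=> [c Hc E] sens.
pose p := \sum_S c S *: 'X^#|S| : {poly R}.
have sp : (size p <= d.+1)%N.
  apply: leq_trans (size_sum _ _ _) _; apply/bigmax_leqP => S _.
  have [->|/Hc le] := eqVneq (c S) 0; first by rewrite scale0r size_poly0.
  by apply: leq_trans (size_scale_leq _ _) _; rewrite size_polyXn.
have wge0 (x : R) (y : input N) : 0 <= x <= 1 -> 0 <= \prod_i (if y i then x else 1 - x).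
  by move=> /andP[x0 x1]; apply: prodr_ge0 => i _; case: ifP; rewrite ?subr_ge0.
have pE x : p.[x] = \sum_(y : input N) (\prod_i (if y i then x else 1 - x)) * (h y)%:R.
  transitivity (\sum_S \sum_(y : input N) c S *
      (\prod_i (if y i then x else 1 - x) * (mono S y)%:R)).
    rewrite horner_sum; apply: eq_bigr => S _.
    by rewrite hornerZ hornerXn -mulr_sumr sum_biased_mono.
  rewrite exchange_big; apply: eq_bigr => y _ /=; rewrite E mulr_sumr.
  by apply: eq_bigr => S _; rewrite mulrCA.
have bp x : 0 <= x <= 1 -> 0 <= p.[x] <= 1.
  move=> x01; rewrite pE sumr_ge0 /=; last by move=> y _; rewrite mulr_ge0 ?wge0.
  have s1 := sum_biased_mono x (set0 : {set 'I_N}); rewrite cards0 expr0 in s1.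
  rewrite -[leRHS]s1; apply: ler_sum => y _; rewrite ler_wpM2l ?wge0 // mono0.
  by case: (h y).
have c0 : (h (ind set0))%:R = c set0.
  rewrite E (bigD1 set0) //= mono0 mulr1 big1 ?addr0 // => S n0.
  by rewrite mono_ind subset0 (negPf n0) mulr0.
have c1 i : c [set i] = (h (ind [set i]))%:R - (h (ind set0))%:R.
  rewrite c0 E (bigD1 set0) //= (bigD1 [set i]) /=; last first.
    by apply/set0Pn; exists i; rewrite set11.
  rewrite !mono_ind sub0set subxx !mulr1 [RHS]addrC addKr big1 ?addr0 // => S /andP[n0 n1].
  by rewrite mono_ind subset1 (negPf n0) (negPf n1) mulr0.
have p1 : p`_1 = \sum_i c [set i].
  transitivity (\sum_(S in [set [set i] | i : 'I_N]) c S).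
    rewrite coef_sum [RHS]big_mkcond; apply: eq_bigr => S _.
    rewrite coefZ coefXn; have [/imsetP[i _ ->]|nS] := boolP (S \in _).
      by rewrite cards1 mulr1.
    have -> : (1%N == #|S|) = false; last by rewrite mulr0.
    by apply: contraNF nS; rewrite eq_sym => /cards1P[i ->]; apply: imset_f.
  rewrite big_imset /=; last by move=> i j _ _; apply: set1_inj.
  by apply: eq_bigl => i; rewrite inE.
(* Since [h] is Boolean, all the differences [h (ind [set i]) - h (ind set0)] have the same sign, so
   nothing cancels in the slope. *)
have : `|p`_1| = N%:R.
  rewrite p1; case: (boolP (h (ind set0))) => h0.
    rewrite (eq_bigr (fun=> -1)) => [|i _].
      by rewrite sumr_const card_ord mulNrn normrN normr_nat.
    by rewrite c1 h0; have := sens i; rewrite h0; case: (h _) => // _; rewrite sub0r.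
  rewrite (eq_bigr (fun=> 1)) => [|i _].
    by rewrite sumr_const card_ord normr_nat.
  by rewrite c1 (negPf h0); have := sens i; rewrite (negPf h0); case: (h _) => // _; rewrite subr0.
move=> e; have := markov_endpoint sp bp; rewrite e.
by rewrite -natrX -natrM ler_nat.
Qed.

(** Substitute one fresh variable for each block. By disjointness every coordinate becomes a single
    variable or 0, so the degree does not grow and each fresh variable is sensitive at 0. *)
Lemma block_sensitivity_le N d (h : input N -> bool) (P : {set {set 'I_N}}) :
  deg_le d (fun x => (h x)%:R : R) -> trivIset P ->
  (forall B, B \in P -> h (ind B) != h (ind set0)) -> (#|P| <= 4 * d ^ 2)%N.
Proof.
move=> dh triv sens.
pose s (J : input #|P|) : input N :=
  [ffun i => [exists k, J k && (i \in (enum_val k : {set 'I_N}))]].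
have sE B : s (ind B) = ind (\bigcup_(k in B) (enum_val k : {set 'I_N})).
  apply/ffunP => i; rewrite !ffunE; apply/existsP/bigcupP => [[k]|[k kB ik]].
    by rewrite ffunE => /andP[kB ik]; exists k.
  by exists k; rewrite ffunE kB.
apply: (@sensitivity_le _ d (h \o s)) => [|k] /=; last first.
  by rewrite !sE big_set1 big_set0 sens // enum_valP.
apply: (deg_comp (s := s) _ dh) => i.
have [/existsP[k ik]|/existsPn ni] :=
    boolP [exists k : 'I_#|P|, i \in (enum_val k : {set 'I_N})].
  apply: deg_ext (deg_var _ k) => J; rewrite ffunE; congr ((nat_of_bool _)%:R).
  apply/idP/existsP => [Jk|[k' /andP[Jk' ik']]]; first by exists k; rewrite Jk.
  suff -> : k = k' by [].
  apply: enum_val_inj; apply/eqP; apply: contraTT ik' => ne.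
  move/trivIsetP: triv => /(_ _ _ (enum_valP k) (enum_valP k') ne).
  by move=> /disjoint_setI0/setP/(_ i); rewrite !inE ik /= => ->.
apply: deg_ext (deg_zero _ _ _) => J; rewrite ffunE.
case: existsP => // -[k /andP[_ ik]]; by have := ni k; rewrite ik.
Qed.

(** If [h] were constant on the indicators of all subsets of [S], induction on the size (Moebius
    inversion) would make every coefficient of a nonempty subset of [S] vanish. *)
Lemma monomial_block N (h : input N -> bool) (c : {set 'I_N} -> R) S :
  (forall x, (h x)%:R = \sum_S c S * (mono S x)%:R) -> S != set0 -> c S != 0 ->
  exists2 B : {set 'I_N}, B \subset S & h (ind B) != h (ind set0).
Proof.
move=> E S0 cS.
have [/existsP[B /andP[BS hB]]|/existsPn con] :=
  boolP [exists B : {set 'I_N}, (B \subset S) && (h (ind B) != h (ind set0))].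
  by exists B.
suff z n : forall B : {set 'I_N}, (#|B| <= n)%N -> B \subset S -> B != set0 -> c B = 0.
  by rewrite (z _ _ (leqnn _) (subxx _) S0) eqxx in cS.
elim: n => [|n IH] B cB BS B0.
  by move: cB; rewrite leqn0 cards_eq0 (negPf B0).
have := con B; rewrite BS /= negbK => /eqP hB.
have := esym (E (ind B)); rewrite hB E.
rewrite (bigD1 set0) //= [in RHS](bigD1 set0) //= (bigD1 B) //=.
rewrite !mono_ind !sub0set subxx !mulr1 !big1 => [||T].
- by rewrite !addr0 => /(canRL (addKr _)) ->; rewrite addNr.
- by move=> T /negPf T0; rewrite mono_ind subset0 T0 mulr0.
- move=> /andP[T0 TB]; rewrite mono_ind.
  have [sTB|] := boolP (T \subset B); last by rewrite mulr0.
  rewrite IH ?mul0r ?(fintype.subset_trans sTB) // -ltnS.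
  apply: leq_trans cB; apply: proper_card; rewrite properEneq TB; exact: sTB.
Qed.

(* U is the union of a maximal disjoint family of monomials of top degree; each
   of them contains a sensitive block at 0. *)
Lemma hitting_set N d k (h : input N -> bool) (c : {set 'I_N} -> R) :
  deg_le d (fun x => (h x)%:R : R) ->
  (forall x, (h x)%:R = \sum_S c S * (mono S x)%:R) ->
  exists2 U : {set 'I_N}, (#|U| <= 4 * d ^ 2 * k.+1)%N &
    forall S : {set 'I_N}, #|S| = k.+1 -> c S != 0 -> S :&: U != set0.
Proof.
move=> dh E.
pose good (P : {set {set 'I_N}}) :=
  trivIset P && [forall S in P, (#|S| == k.+1) && (c S != 0)].
have good0 : good set0.
  apply/andP; split; first by apply/trivIsetP => A B; rewrite inE.
  by apply/forallP => S; rewrite inE.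
have [P /maxsetP[/andP[triv /forallP Pg] Pmax] _] := maxset_exists good0.
exists (cover P) => [|S cardS cS].
  rewrite -(eqP triv) (eq_bigr (fun=> k.+1)) => [|S SP]; last first.
    by have := Pg S; rewrite SP => /andP[/eqP].
  rewrite sum_nat_const leq_mul2r; apply/orP; right.
  (* Choose a sensitive block inside each member of [P]. These blocks are disjoint and nonempty,
     hence distinct, and block sensitivity bounds their number. *)
  have /fin_all_exists[b Hb] (S : {set 'I_N}) : exists B : {set 'I_N},
      S \in P -> B \subset S /\ h (ind B) != h (ind set0).
    have [SP|] := boolP (S \in P); last by exists set0.
    have := Pg S; rewrite SP /= => /andP[/eqP cardS cS].
    have S0 : S != set0 by rewrite -card_gt0 cardS.
    by have [B BS hB] := monomial_block E S0 cS; exists B.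
  have sub0 B : h (ind B) != h (ind set0) -> B != set0.
    by apply: contraNneq => ->.
  have binj : {in P &, injective b}.
    move=> S T SP TP eb; apply/eqP; apply/negPn/negP => ne.
    have [bS hS] := Hb S SP; have [bT _] := Hb T TP.
    move/trivIsetP: triv => /(_ _ _ SP TP ne) /disjoint_setI0 dis.
    have /negP := sub0 _ hS; apply; rewrite -subset0 -dis subsetI bS eb.
    exact: bT.
  rewrite -(card_in_imset binj).
  apply: (block_sensitivity_le dh) => [|B /imsetP[S SP ->]]; last by case: (Hb S SP).
  apply/trivIsetP => _ _ /imsetP[S SP ->] /imsetP[T TP ->] ne.
  have nST : S != T by apply: contraNneq ne => ->.
  move/trivIsetP: triv => /(_ _ _ SP TP nST) dis.
  by apply: disjointWl (proj1 (Hb S SP)) (disjointWr (proj1 (Hb T TP)) dis).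
(* A monomial missing the cover could be added to [P]; by maximality it already lies in [P], hence
   inside the cover, which forces it to be empty. *)
apply/negP => /eqP SU.
have SP : S \in P.
  suff -> : P = S |: P by rewrite setU11.
  symmetry; apply: Pmax; last exact: subsetUr.
  apply/andP; split; last first.
    apply/forallP => T; rewrite !inE; apply/implyP => /orP[/eqP->|TP].
      by rewrite cardS eqxx.
    by have := Pg T; rewrite TP.
  have disS T : T \in P -> [disjoint S & T].
    move=> TP; rewrite -setI_eq0 -subset0 -SU setIS //.
    exact: bigcup_sup.
  apply/trivIsetP => A B; rewrite !inE => /orP[/eqP->|AP] /orP[/eqP->|BP] ne.
  - by rewrite eqxx in ne.
  - exact: disS.
  - by rewrite disjoint_sym; apply: disS.
  - by move/trivIsetP: triv; apply.
have : S \subset S :&: cover P by rewrite subsetI subxx bigcup_sup.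
by rewrite SU subset0 -cards_eq0 cardS.
Qed.

(** Restricting [h] to the values of [x] on [U] is [fun y => h (merge x y U)], which is still a
    function of all N coordinates. *)
Definition merge N (x y : input N) (U : {set 'I_N}) : input N :=
  [ffun i => if i \in U then x i else y i].

Lemma deg_merge N d (h : input N -> R) x (U : {set 'I_N}) :
  deg_le d h -> deg_le d (fun y => h (merge x y U)).
Proof.
apply: deg_comp => i; have [iU|iU] := boolP (i \in U).
  by apply: deg_ext (deg_const _ _ (x i)%:R) => y; rewrite ffunE iU.
by apply: deg_ext (deg_var _ i) => y; rewrite ffunE (negPf iU).
Qed.

(** Fixing a hitting set removes at least one variable from every monomial of degree [k.+1]. One [U]
    serves all answers [x], and [d] enters its size through block sensitivity. *)
Lemma degree_drop N d k (h : input N -> bool) :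
  deg_le d (fun x => (h x)%:R : R) -> deg_le k.+1 (fun x => (h x)%:R : R) ->
  exists U : {set 'I_N}, (#|U| <= 4 * d ^ 2 * k.+1)%N /\
    forall x, deg_le k (fun y => (h (merge x y U))%:R : R).
Proof.
move=> dh [c Hc E]; have [U cU HU] := hitting_set k dh E.
exists U; split => // x.
apply: (@deg_ext _ _ _ (fun y => \sum_S c S * (mono S (merge x y U))%:R)) => [y|].
  by rewrite E.
apply: deg_sum => S _; have [->|cS] := eqVneq (c S) 0.
  by apply: deg_ext (deg_zero _ _ _) => y; rewrite mul0r.
apply: deg_scale.
have mer i : deg_le (i \notin U) (fun y => (merge x y U i)%:R : R).
  have [iU|iU] := boolP (i \in U).
    by apply: deg_ext (deg_const _ _ (x i)%:R) => y; rewrite ffunE iU.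
  by apply: deg_ext (deg_var _ i) => y; rewrite ffunE (negPf iU).
apply: deg_weaken (deg_comp_mono S mer).
have -> : (\sum_(i in S) (i \notin U) = #|S :\: U|)%N.
  rewrite -sum1_card [RHS]big_mkcond [LHS]big_mkcond; apply: eq_bigr => i _.
  by rewrite inE; case: (i \in S); case: (i \in U).
have := Hc S cS; rewrite leq_eqVlt => /orP[/eqP cardS|]; last first.
  by rewrite ltnS; apply: leq_trans; rewrite subset_leq_card // subsetDl.
rewrite -ltnS -cardS; apply: proper_card; rewrite properEneq subsetDl andbT.
have := HU S cardS cS; apply: contra => /eqP e.
by rewrite -e setIDAC -setIDA setDv setI0.
Qed.

(* Q x is the set of positions that a decision tree for h reads on x. *)
Lemma query_set N d (h : input N -> bool) :
  deg_le d (fun x => (h x)%:R : R) ->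
  exists Q : input N -> {set 'I_N},
    (forall x, (#|Q x| <= 4 * d ^ 4)%N) /\
    (forall x y : input N, {in Q x, x =1 y} -> Q y = Q x /\ h y = h x).
Proof.
move=> dh.
(* After j rounds of at most 4 d^3 queries the restricted function has degree at most d - j; after d
   rounds it is constant. *)
suff G j : (j <= d)%N -> exists Q : input N -> {set 'I_N},
    [/\ forall x, (#|Q x| <= j * (4 * d ^ 3))%N,
        forall x y : input N, {in Q x, x =1 y} -> Q y = Q x
      & forall x, deg_le (d - j) (fun y => (h (merge x y (Q x)))%:R : R)].
  have [Q [cQ locQ degQ]] := G d (leqnn d); exists Q; split => [x|x y xy].
    by rewrite (leq_trans (cQ x)) // mulnCA -expnS.
  split; first exact: locQ.
  have [c Hc E] := degQ x; rewrite subnn in Hc.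
  have cst z : (h (merge x z (Q x)))%:R = c set0.
    rewrite E (bigD1 set0) //= mono0 mulr1 big1 ?addr0 // => S S0.
    have [->|/Hc] := eqVneq (c S) 0; first by rewrite mul0r.
    by rewrite leqn0 cards_eq0 (negPf S0).
  have ex : merge x x (Q x) = x by apply/ffunP => i; rewrite ffunE if_same.
  have ey : merge x y (Q x) = y.
    by apply/ffunP => i; rewrite ffunE; case: ifP => // /xy.
  have := etrans (cst x) (esym (cst y)); rewrite ex ey => /eqP.
  by rewrite eqr_nat; case: (h x); case: (h y).
elim: j => [_|j IH lt].
  exists (fun=> set0); split => [x|x y //|x]; first by rewrite cards0.
  by rewrite subn0; exact: (deg_merge x set0 dh).
have [Q [cQ locQ degQ]] := IH (ltnW lt).
have dj : (d - j = (d - j.+1).+1)%N by lia.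
(* The next set is chosen as a function of the restricted function alone, so inputs giving the same
   answers are queried at the same positions. *)
have /fin_all_exists[U HU] (g : {ffun input N -> bool}) : exists U : {set 'I_N},
    deg_le d (fun x => (g x)%:R : R) -> deg_le (d - j) (fun x => (g x)%:R : R) ->
    (#|U| <= 4 * d ^ 2 * (d - j))%N /\
    forall x, deg_le (d - j.+1) (fun y => (g (merge x y U))%:R : R).
  have [dg|?] := pselect (deg_le d (fun x => (g x)%:R : R)); last by exists set0.
  have [kg|?] := pselect (deg_le (d - j) (fun x => (g x)%:R : R)); last by exists set0.
  rewrite dj in kg *.
  by have [U HU] := degree_drop dg kg; exists U.
pose g x : {ffun input N -> bool} := [ffun y => h (merge x y (Q x))].
have gE x : (fun y => (h (merge x y (Q x)))%:R : R) =1 (fun y => (g x y)%:R).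
  by move=> y; rewrite ffunE.
have HUx x := HU (g x) (deg_ext (gE x) (deg_merge x (Q x) dh)) (deg_ext (gE x) (degQ x)).
exists (fun x => Q x :|: U (g x)); split => [x|x y xy|x].
- rewrite cardsU (leq_trans (leq_subr _ _)) // mulSn addnC leq_add ?cQ //.
  apply: leq_trans (proj1 (HUx x)) _.
  by rewrite (expnSr d 2) mulnA leq_mul2l leq_subr orbT.
- have eQ : Q y = Q x by apply: locQ => i iQ; apply: xy; rewrite inE iQ.
  rewrite eQ; congr (_ :|: U _); apply/ffunP => z; rewrite !ffunE eQ; congr h.
  by apply/ffunP => i; rewrite !ffunE; case: ifP => // iQ; rewrite xy // inE iQ.
- apply: deg_ext (proj2 (HUx x) x) => y; rewrite ffunE; congr ((h _)%:R).
  by apply/ffunP => i; rewrite !ffunE inE; case: (i \in Q x); case: (i \in U _).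
Qed.
End Boolean.

(** * The polynomial method *)

Section PolynomialMethod.
Variable R : realType.
Local Notation C := R[i].

Lemma normc_sqr (z : C) :
  ComplexField.Normc.normc z ^+ 2 = complex.Re z ^+ 2 + complex.Im z ^+ 2.
Proof. by case: z => a b /=; rewrite sqr_sqrtr // addr_ge0 ?sqr_ge0. Qed.

Lemma deg_Re N d (h : input N -> C) :
  deg_le d h -> deg_le d (fun x => complex.Re (h x)).
Proof.
move=> [c Hc E]; exists (fun S => complex.Re (c S)) => [S|x].
  by move=> n; apply: Hc; apply: contraNneq n => ->.
rewrite E raddf_sum; apply: eq_bigr => S _.
by case: (mono _ _); rewrite ?mulr1 ?mulr0.
Qed.

Lemma deg_Im N d (h : input N -> C) :
  deg_le d h -> deg_le d (fun x => complex.Im (h x)).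
Proof.
move=> [c Hc E]; exists (fun S => complex.Im (c S)) => [S|x].
  by move=> n; apply: Hc; apply: contraNneq n => ->.
rewrite E raddf_sum; apply: eq_bigr => S _.
by case: (mono _ _); rewrite ?mulr1 ?mulr0.
Qed.

Lemma deg_oracle N w r c : deg_le 1 (fun x : input N => oracle R w x r c).
Proof.
case Ec: (enum_val c) => [[i b] z].
pose a v : C := (enum_val r == (i, b (+) v, z))%:R.
apply: (@deg_ext _ _ _ (fun x => a true * (x i)%:R + (a false + - a false * (x i)%:R))).
  move=> x; rewrite mxE Ec /= -/(a (x i)).
  by case: (x i); rewrite ?mulr1 ?mulr0 ?subrr ?addr0 ?add0r.
by apply: deg_add; [|apply: deg_add; [apply: deg_const|]]; apply/deg_scale/deg_var.
Qed.

Lemma deg_mulmx N m n p d1 d2 (A : input N -> 'M[C]_(m, n)) (B : input N -> 'M[C]_(n, p)) :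
  (forall i j, deg_le d1 (fun x => A x i j)) ->
  (forall i j, deg_le d2 (fun x => B x i j)) ->
  forall i j, deg_le (d1 + d2) (fun x => (A x *m B x) i j).
Proof.
move=> HA HB i j.
apply: (@deg_ext _ _ _ (fun x => \sum_k A x i k * B x k j)) => [x|]; first by rewrite mxE.
by apply: deg_sum => k _; apply: deg_mul.
Qed.

(** Oracle entries are affine in the input and the unitaries are constant, so each query raises the
    degree of the amplitudes by at most one. *)
Lemma deg_final_state N T (A : qalg R N T) i j :
  deg_le T (fun x => final_state A x i j).
Proof.
rewrite /final_state /qoperator; case: A i j => w U0 s _ _ /= i j.
have cst n p (M : 'M[C]_(n, p)) i' j' : deg_le 0 (fun _ : input N => M i' j').
  exact: deg_const.
apply: (@deg_weaken _ _ (T + 0)); first by rewrite addn0.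
apply: deg_mulmx => // {}i {}j.
suff G (l : seq 'M[C]_(qdim N w)) : forall d (M : input N -> 'M[C]_(qdim N w)),
    (forall i j, deg_le d (fun x => M x i j)) -> forall i j,
    deg_le (size l + d) (fun x => foldl (fun M U => U *m oracle R w x *m M) (M x) l i j).
  by have := G s 0%N (fun=> U0) (cst _ _ _) i j; rewrite size_tuple addn0.
elim: l => [|U l IH] d M HM i' j' //=.
rewrite addSnnS; apply: IH => {i' j'} i' j'.
rewrite -add1n; apply: deg_mulmx => // {i' j'} i' j'.
by rewrite -[1%N]add0n; apply: deg_mulmx => // *; apply: deg_oracle.
Qed.

Lemma deg_accept_prob N T (A : qalg R N T) : deg_le (T + T) (accept_prob A).
Proof.
apply: deg_sum => k _.
apply: (@deg_ext _ _ _ (fun x =>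
  complex.Re (final_state A x k 0) * complex.Re (final_state A x k 0) +
  complex.Im (final_state A x k 0) * complex.Im (final_state A x k 0))).
  by move=> x; rewrite normc_sqr !expr2.
have H := @deg_final_state _ _ A k 0.
by apply: deg_add; apply: deg_mul; (exact: deg_Re || exact: deg_Im).
Qed.

End PolynomialMethod.

(** * Fourier analysis on the cube *)

Notation bits m := {ffun 'I_m -> bool}.

Definition bxor m (x y : bits m) : bits m := [ffun i => x i (+) y i].
Definition bzero m : bits m := [ffun=> false].

Section Xor.
Variable m : nat.
Implicit Types x y s : bits m.

Lemma bxorC x y : bxor x y = bxor y x.
Proof. by apply/ffunP => i; rewrite !ffunE addbC. Qed.

Lemma bxorA x y z : bxor x (bxor y z) = bxor (bxor x y) z.
Proof. by apply/ffunP => i; rewrite !ffunE addbA. Qed.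

Lemma bxorK x y : bxor (bxor x y) y = x.
Proof. by apply/ffunP => i; rewrite !ffunE addbK. Qed.

Lemma bxorx x : bxor x x = bzero m.
Proof. by apply/ffunP => i; rewrite !ffunE addbb. Qed.

Lemma bxor0 x : bxor x (bzero m) = x.
Proof. by apply/ffunP => i; rewrite !ffunE addbF. Qed.

Lemma bxor_eq x y z : (bxor x y == z) = (x == bxor z y).
Proof. by apply/eqP/eqP => [<-|->]; rewrite bxorK. Qed.

Lemma bxor_eq0 x y : (bxor x y == bzero m) = (x == y).
Proof. by rewrite bxor_eq bxorC bxor0. Qed.

Lemma bxor_neq x s : s != bzero m -> bxor x s != x.
Proof. by apply: contraNneq => e; rewrite -(bxorK s x) (bxorC s) e bxorx. Qed.

End Xor.

Section Fourier.
Variable R : realFieldType.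
Variable m : nat.
Implicit Types (x y s : bits m) (F : {ffun bits m -> bool}).

Definition bsgn (b : bool) : R := (-1) ^+ b.

Definition chi x y : R := \prod_i bsgn (x i && y i).

Lemma bsgnD a b : bsgn (a (+) b) = bsgn a * bsgn b.
Proof. by rewrite /bsgn signr_addb. Qed.

Lemma bsgn_sqr b : bsgn b * bsgn b = 1.
Proof. by rewrite -bsgnD addbb. Qed.

Lemma chiC x y : chi x y = chi y x.
Proof. by apply: eq_bigr => i _; rewrite andbC. Qed.

Lemma chiD x y z : chi (bxor x y) z = chi x z * chi y z.
Proof.
rewrite -big_split; apply: eq_bigr => i _ /=.
by rewrite ffunE andb_addl bsgnD.
Qed.

Lemma chi0 y : chi (bzero m) y = 1.
Proof. by rewrite /chi big1 // => i _; rewrite ffunE. Qed.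

Definition bdot x y : bool := \big[addb/false]_i (x i && y i).

Lemma chiE x y : chi x y = bsgn (bdot x y).
Proof. by rewrite (big_morph bsgn bsgnD (erefl _)). Qed.

Lemma sum_chi x : \sum_y chi x y = (x == bzero m)%:R * 2 ^+ m.
Proof.
transitivity (\prod_(i < m) \sum_(b : bool) bsgn (x i && b)).
  by rewrite bigA_distr_bigA.
have [->|] := eqVneq x (bzero m).
  rewrite mul1r -[in RHS](card_ord m) -prodr_const; apply: eq_bigr => i _.
  by rewrite big_bool ffunE /= /bsgn expr0.
move=> x0; have [i xi] : exists i, x i.
  apply/existsP; apply: contraNT x0 => /existsPn no; apply/eqP/ffunP => i.
  by rewrite ffunE; apply/negbTE/no.
by rewrite mul0r (bigD1 i) //= big_bool xi /bsgn /= addNr mul0r.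
Qed.

Definition fhat F y : R := \sum_x bsgn (F x) * chi x y / 2 ^+ m.

Definition autocorr F s : R := \sum_x bsgn (F x) * bsgn (F (bxor x s)) / 2 ^+ m.

Let two0 : (2 ^+ m : R) != 0.
Proof. by rewrite expf_neq0 // pnatr_eq0. Qed.

Lemma autocorr0 F : autocorr F (bzero m) = 1.
Proof.
rewrite /autocorr (eq_bigr (fun=> (2 ^+ m)^-1)) => [|x _].
  rewrite sumr_const card_ffun card_bool card_ord -[X in X *+ _]mul1r -mulrnAl natrX.
  by rewrite divff.
by rewrite bxor0 bsgn_sqr mul1r.
Qed.

(** The Wiener-Khinchin identity: after expanding the square, [sum_chi] keeps only the pairs (x, x +
    s). *)
Lemma sum_chi_fhat2 F s : \sum_y chi s y * fhat F y ^+ 2 = autocorr F s.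
Proof.
transitivity (\sum_x \sum_x' (bsgn (F x) * bsgn (F x') / (2 ^+ m * 2 ^+ m)) *
    \sum_y chi (bxor s (bxor x x')) y).
  rewrite (eq_bigr (fun y => \sum_x \sum_x' (bsgn (F x) * bsgn (F x') / (2 ^+ m * 2 ^+ m)) *
     chi (bxor s (bxor x x')) y)) => [|y _].
    rewrite exchange_big; apply: eq_bigr => x _; rewrite exchange_big.
    by apply: eq_bigr => x' _; rewrite mulr_sumr.
  rewrite expr2 mulr_suml mulr_sumr; apply: eq_bigr => x _.
  rewrite mulr_sumr mulr_sumr; apply: eq_bigr => x' _.
  by rewrite !chiD; field.
apply: eq_bigr => x _; rewrite (bigD1 (bxor x s)) //= [X in _ + X]big1 ?addr0 => [|x' ne].
  rewrite sum_chi (_ : bxor s _ = bzero m) ?eqxx ?mul1r; first by field.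
  by rewrite bxorA (bxorC s) bxorx.
rewrite sum_chi (_ : _ == _ = false) ?mul0r ?mulr0 //; apply: contraNF ne.
by rewrite bxorC bxor_eq0 bxorC bxor_eq => /eqP->; rewrite bxorC.
Qed.

(** The probability that a Fourier sample of [F] is orthogonal to [s]. *)
Definition weight F s : R := \sum_(y | ~~ bdot s y) fhat F y ^+ 2.

Lemma weightE F s : weight F s = (1 + autocorr F s) / 2.
Proof.
rewrite -[X in X + _](autocorr0 F) -!sum_chi_fhat2 -big_split /= mulr_suml /weight big_mkcond /=.
apply: eq_bigr => y _; rewrite chi0 (chiE s) /bsgn.
case: (bdot s y); rewrite /= ?expr1 ?expr0 ?mul1r ?mulN1r ?subrr ?mul0r //.
by field.
Qed.

Lemma sum_fhat2 F : \sum_y fhat F y ^+ 2 = 1.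
Proof.
rewrite -(autocorr0 F) -sum_chi_fhat2; apply: eq_bigr => y _.
by rewrite chi0 mul1r.
Qed.

(** A period has autocorrelation 1, so the total mass 1 already lies on the vectors orthogonal to
    [s]. *)
Lemma fhat_periodic F s y : (forall x, F (bxor x s) = F x) -> bdot s y -> fhat F y = 0.
Proof.
move=> per dot; have : weight F s = 1.
  rewrite weightE (_ : autocorr F s = 1); first by field.
  by rewrite -(autocorr0 F); apply: eq_bigr => x _; rewrite per bxor0.
rewrite -[RHS](sum_fhat2 F) [RHS](bigID (fun y => ~~ bdot s y)) /= -/(weight F s).
move/(canLR (addKr _)); rewrite addNr => /eqP; rewrite eq_sym.
rewrite psumr_eq0 => [|z _]; last exact: sqr_ge0.
by move=> /allP/(_ y); rewrite mem_index_enum negbK dot sqrf_eq0 => /(_ isT)/eqP.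
Qed.

Lemma norm_autocorr_le1 F s : -1 <= autocorr F s <= 1.
Proof.
have w0 : 0 <= weight F s by apply: sumr_ge0 => y _; apply: sqr_ge0.
have w1 : weight F s <= 1.
  rewrite -(sum_fhat2 F) [leRHS](bigID (fun y => ~~ bdot s y)) /= lerDl.
  by apply: sumr_ge0 => y _; apply: sqr_ge0.
by move: w0 w1; rewrite weightE => w0 w1; apply/andP; split; lra.
Qed.

(** For random F the summands at x and z are uncorrelated unless z is x or x + s, where they are
    equal; 2 * 2^m of the 4^m pairs survive. *)
Lemma sum_autocorr2 s : s != bzero m ->
  \sum_(F : {ffun bits m -> bool}) autocorr F s ^+ 2 =
  2 / 2 ^+ m * #|{ffun bits m -> bool}|%:R.
Proof.
move=> s0.
pose flip (u : bits m) F : {ffun bits m -> bool} := [ffun x => F x (+) (x == u)].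
have flipK u : involutive (flip u).
  by move=> F; apply/ffunP => x; rewrite !ffunE addbK.
pose t F x := bsgn (F x) * bsgn (F (bxor x s)).
(* Flipping the value at x changes the sign of the summand. *)
have off x z : z != x -> z != bxor x s -> \sum_F t F x * t F z = 0.
  move=> zx zxs; set S := \sum_F _.
  suff : S = - S by lra.
  rewrite {1}/S (reindex_inj (inv_inj (flipK x))) /= -sumrN; apply: eq_bigr => F _.
  rewrite /t !ffunE eqxx (negPf zx) (negPf (bxor_neq x s0)) bxor_eq (negPf zxs) !addbF.
  by rewrite addbT /bsgn signrN !mulNr.
have diag F x : t F x * t F x = 1.
  by rewrite /t mulrACA !bsgn_sqr mulr1.
have tper F x : t F (bxor x s) = t F x by rewrite /t bxorK mulrC.
transitivity (\sum_x \sum_z (\sum_F t F x * t F z) / (2 ^+ m * 2 ^+ m)).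
  transitivity (\sum_F \sum_x \sum_z t F x * t F z / (2 ^+ m * 2 ^+ m)).
    apply: eq_bigr => F _; rewrite expr2 mulr_suml; apply: eq_bigr => x _.
    by rewrite mulr_sumr; apply: eq_bigr => z _; rewrite /t; field.
  rewrite exchange_big; apply: eq_bigr => x _; rewrite exchange_big.
  by apply: eq_bigr => z _; rewrite mulr_suml.
rewrite (eq_bigr (fun=> 2 * #|{ffun bits m -> bool}|%:R / (2 ^+ m * 2 ^+ m))) => [|x _].
  move: (#|_|%:R) => M; rewrite sumr_const card_ffun card_bool card_ord.
  by rewrite -[LHS]mulr_natr natrX; field.
rewrite (bigD1 x) //= (bigD1 (bxor x s)) ?bxor_neq //= [X in _ + (_ + X)]big1 => [|z].
  have cnt z : (forall F, t F x * t F z = 1) ->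
      \sum_F t F x * t F z = #|{ffun bits m -> bool}|%:R.
    by move=> e; rewrite (eq_bigr (fun=> 1)) ?sumr_const // => F _; apply: e.
  rewrite !cnt ?addr0; [by field|by move=> F; rewrite tper diag|by move=> F; apply: diag].
by move=> /andP[zx zxs]; rewrite off ?mul0r.
Qed.

End Fourier.

(** * Fourier sampling as a query algorithm *)

Lemma card_bij (A B : finType) : #|A| = #|B| -> exists f : A -> B, bijective f.
Proof.
move=> e; exists (fun a => enum_val (cast_ord e (enum_rank a))).
exists (fun b => enum_val (cast_ord (esym e) (enum_rank b))) => x.
  by rewrite enum_valK cast_ordK enum_rankK.
by rewrite enum_valK cast_ordKV enum_rankK.
Qed.

Section Kernels.
Variables (R : realType) (L : finType) (n : nat) (idx : 'I_n -> L).
Hypothesis idx_bij : bijective idx.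
Local Notation C := R[i].

(** All operators of the algorithm are real, so they are handled as kernels over a convenient label
    type and carried to matrices by [idx]. *)
Definition mxk (K : L -> L -> R) : 'M[C]_n := \matrix_(r, c) (K (idx r) (idx c))%:C%C.
Definition colk (v : L -> R) : 'cV[C]_n := \col_k (v (idx k))%:C%C.

Definition act (K : L -> L -> R) (v : L -> R) (a : L) : R := \sum_l K a l * v l.

Lemma mxk_col K v : mxk K *m colk v = colk (act K v).
Proof.
apply/colP => k; rewrite !mxE /act rmorph_sum (reindex idx) /=; last exact: onW_bij.
by apply: eq_bigr => j _; rewrite !mxE rmorphM.
Qed.

Lemma mxk_unitary K :
  (forall a b, \sum_l K a l * K b l = (a == b)%:R) -> mxk K \is unitarymx.
Proof.
move=> H; apply/unitarymxP/matrixP => r c; rewrite !mxE.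
rewrite -(inj_eq (bij_inj idx_bij)) -(rmorph_nat (real_complex R)) -H rmorph_sum.
rewrite [RHS](reindex idx) /=; last exact: onW_bij.
apply: eq_bigr => j _; rewrite !mxE rmorphM; congr (_ * _); exact: (conjc_real _).
Qed.

Definition permk (s : L -> L) (a l : L) : R := (a == s l)%:R.

Lemma act_permk s v : involutive s -> act (permk s) v = v \o s.
Proof.
move=> sK; apply/funext => a; rewrite /act (bigD1 (s a)) //= /permk sK eqxx mul1r.
rewrite big1 ?addr0 // => l ne; rewrite (_ : _ == _ = false) ?mul0r //.
by apply: contraNF ne => /eqP->; rewrite sK.
Qed.

Lemma permk_unitary s : involutive s -> mxk (permk s) \is unitarymx.
Proof.
move=> sK; apply: mxk_unitary => a b.
have := act_permk (permk s b) sK => /(congr1 (@^~ a)) /=; rewrite /act => ->.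
by rewrite /permk sK eq_sym.
Qed.

End Kernels.

Section Algorithm.
Variables (R : realType) (N m T : nat) (pos : bits m -> 'I_N).
Variables (i0 : 'I_N) (i00 : i0 = 0%N :> nat).
Let Y := {ffun 'I_T -> bits m}.
Variable p : Y -> bool.

Let L : finType := ('I_N * bool * Y * bool)%type.
Let w := (T * m).+1.

Lemma card_samples : #|{: Y}| = #|{: (T * m).-tuple bool}|.
Proof. by rewrite !card_ffun card_tuple !card_ord !card_bool mulnC expnM. Qed.

(* The last workspace bit holds the answer, the others encode the T samples
   through an arbitrary bijection. *)
Let enc (e : Y -> (T * m).-tuple bool) (a : L) : label N w :=
  let: (i, b, y, l) := a in (i, b, [tuple of rcons (e y) l]).

(** Collects how the output bit, the query and the zero label look in the structured labels. The
    samples encoded by the zero string depend on the arbitrary bijection, hence the unspecified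
    [l0]. *)
Lemma ex_index : exists idx : 'I_(qdim N w) -> L,
  [/\ bijective idx,
      forall k, rightmost (enum_val k) = (idx k).2 &
      forall X r c, (enum_val r == query_label X (enum_val c)) =
        (idx r == let: (i, b, y, l) := idx c in (i, b (+) X i, y, l))] /\
  exists l0, forall k, is_zero_label (enum_val k) = (idx k == l0).
Proof.
have [e eb] := card_bij card_samples.
have enc_inj : injective (enc e).
  move=> [[[i b] y] l] [[[i' b'] y'] l'] [-> ->] /rcons_inj[/val_inj/(bij_inj eb)-> ->] //.
have [|dec decK encK] := inj_card_bij enc_inj.
  by rewrite /label !card_prod card_tuple card_samples card_tuple !card_bool expnSr mulnA.
exists (fun k => dec (enum_val k)); split; last first.
  exists (dec (i0, false, [tuple of nseq w false])) => k.
  rewrite (can_eq encK); case: (enum_val k) => [[i b] z] /=.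
  rewrite !xpair_eqE -(inj_eq val_inj) /= i00; case: (_ == _) => //=; case: b => //=.
  apply/idP/eqP => [/hasPn hz|->]; last by rewrite /= has_nseq andbF.
  apply: val_inj => /=; suff -> : tval z = nseq (size z) false by rewrite size_tuple.
  by apply/all_pred1P/allP => b bz; have := hz b bz; case: b {bz}.
split.
- exists (fun a => enum_rank (enc e a)) => x; first by rewrite encK enum_valK.
  by rewrite enum_rankK decK.
- move=> k; rewrite -[in LHS](encK (enum_val k)); case: (dec _) => [[[i b] y] l] /=.
  by rewrite last_rcons.
- move=> X r c; rewrite -{1}(encK (enum_val r)) -{1}(encK (enum_val c)).
  by case: (dec (enum_val c)) => [[[i b] y] l]; rewrite -(inj_eq enc_inj).
Qed.

Definition chiT (y z : Y) : R := \prod_j chi R (y j) (z j).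

(** The transform acts on two single bits and T * m sample bits, a space of dimension 4 * 2^(T
    m). *)
Let kap : R := Num.sqrt (4 * 2 ^+ (T * m))^-1.

(* The Hadamard transform on all qubits except the index register. *)
Definition hadamard (a c : L) : R :=
  let: (i, b, y, l) := a in let: (i', b', y', l') := c in
  (i == i')%:R * (kap * bsgn R (b && b') * bsgn R (l && l') * chiT y y').

Let kap2 : kap * kap = (4 * 2 ^+ (T * m))^-1.
Proof. by rewrite -expr2 sqr_sqrtr // invr_ge0 mulr_ge0 // exprn_ge0. Qed.

Lemma sum_labels (G : L -> R) :
  \sum_a G a = \sum_i \sum_b \sum_y \sum_l G (i, b, y, l).
Proof.
rewrite pair_bigA pair_bigA pair_bigA /=; apply: eq_bigr.
by move=> [[[i b] y] l] _.
Qed.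

Lemma sum_prod_samples (g : 'I_T -> bits m -> R) :
  \sum_(y : Y) \prod_j g j (y j) = \prod_j \sum_x g j x.
Proof. by rewrite bigA_distr_bigA. Qed.

Lemma sum_chiT y z : \sum_u chiT y u * chiT z u = (y == z)%:R * 2 ^+ (T * m).
Proof.
transitivity (\prod_(j < T) ((y j == z j)%:R * 2 ^+ m) : R).
  rewrite -(eq_bigr _ (fun j _ => congr1 (fun b : bool => b%:R * 2 ^+ m) (bxor_eq0 (y j) (z j)))).
  under [RHS]eq_bigr do rewrite -sum_chi.
  rewrite -sum_prod_samples; apply: eq_bigr => u _.
  by rewrite -big_split; apply: eq_bigr => j _; rewrite chiD.
rewrite big_split /= prodr_const card_ord -exprM mulnC; congr (_ * _).
have [->|ne] := eqVneq y z; first by rewrite big1 // => j _; rewrite eqxx.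
have [j /negPf nj] : exists j, y j != z j.
  apply/existsP; apply: contraNT ne => /existsPn e; apply/eqP/ffunP => j.
  by apply/eqP; rewrite -[_ == _]negbK.
by rewrite (bigD1 j) //= nj mul0r.
Qed.

Lemma sum_bsgn b c : \sum_d bsgn R (b && d) * bsgn R (c && d) = (b == c)%:R * 2.
Proof. by rewrite big_bool; case: b; case: c; rewrite /bsgn /= ?expr0 ?expr1; ring. Qed.

Lemma hadamard_orthonormal a c : \sum_l hadamard a l * hadamard c l = (a == c)%:R.
Proof.
case: a c => [[[i b] y] l] [[[i' b'] y'] l'].
transitivity ((\sum_k (i == k)%:R * (i' == k)%:R) * ((kap * kap) *
   ((\sum_d bsgn R (b && d) * bsgn R (b' && d)) *
   ((\sum_u chiT y u * chiT y' u) * (\sum_d bsgn R (l && d) * bsgn R (l' && d)))))).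
  rewrite sum_labels mulr_suml; apply: eq_bigr => k _.
  rewrite mulrA [in RHS]mulr_suml mulr_sumr; apply: eq_bigr => d _.
  rewrite mulr_suml !mulr_sumr; apply: eq_bigr => u _.
  by rewrite !mulr_sumr; apply: eq_bigr => d' _; rewrite /hadamard; ring.
rewrite !sum_bsgn sum_chiT kap2 (bigD1 i) //= eqxx mul1r big1 ?addr0 => [|k ne]; last first.
  by rewrite eq_sym (negPf ne) mul0r.
have -> : (i, b, y, l) == (i', b', y', l') = [&& i' == i, b == b', l == l' & y == y'].
  rewrite !xpair_eqE (eq_sym i).
  by case: (i' == i); case: (b == b'); case: (y == y'); case: (l == l').
rewrite -!mulnb !natrM; field.
by rewrite expf_neq0 // pnatr_eq0.
Qed.

Definition xpos (j : nat) (y : Y) : 'I_N :=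
  if insub j is Some k then pos (y k) else i0.

(* Exchanges the index i0 with the position of the j-th sample, so that the
   index register can be moved from one sample to the next. *)
Definition ctrl (j : nat) (a : L) : L :=
  let: (i, b, y, l) := a in (tperm i0 (xpos j y) i, b, y, l).

Definition flag (a : L) : L := let: (i, b, y, l) := a in (i, b, y, l (+) p y).

Definition query (X : input N) (a : L) : L :=
  let: (i, b, y, l) := a in (i, b (+) X i, y, l).

(** With target bit 1 the Hadamard transform prepares |0> - |1>, so that queries act as phases. *)
Definition start : L := (i0, true, [ffun=> bzero m], false).

Lemma ctrlK j : involutive (ctrl j).
Proof. by move=> [[[i b] y] l]; rewrite /ctrl tpermK. Qed.

Lemma flagK : involutive flag.
Proof. by move=> [[[i b] y] l]; rewrite /flag addbK. Qed.

Lemma queryK X : involutive (query X).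
Proof. by move=> [[[i b] y] l]; rewrite /query addbK. Qed.

(* The uniform superposition of all samples with the target qubit in the state
   |0> - |1>, after the phases of the first t samples have been queried. *)
Definition phase_state (F : {ffun bits m -> bool}) (t : nat) (a : L) : R :=
  let: (i, b, y, l) := a in
  (i == i0)%:R * (kap * bsgn R b * \prod_(j < T | (j < t)%N) bsgn R (F (y j))).

Lemma act_delta (K : L -> L -> R) c : act K (fun a => (a == c)%:R) = K^~ c.
Proof.
apply/funext => a; rewrite /act (bigD1 c) //= eqxx mulr1 big1 ?addr0 // => l ne.
by rewrite (negPf ne) mulr0.
Qed.

Lemma hadamard_start F : hadamard^~ start = phase_state F 0.
Proof.
apply/funext => -[[[i b] y] l]; rewrite /hadamard /phase_state /start.
rewrite andbT andbF big_pred0 // /chiT big1 => [|j _]; first by rewrite /bsgn expr0 !mulr1.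
by rewrite ffunE chiC chi0.
Qed.

(** Phase kickback: [ctrl t] moves the index to the position of sample t, the query flips the target
    by [F (y t)] and so multiplies by a sign, and the second [ctrl t] restores the index. *)
Lemma phase_stateS (X : input N) (F : {ffun bits m -> bool}) t :
  (forall x, X (pos x) = F x) -> (t < T)%N ->
  phase_state F t \o (ctrl t \o query X \o ctrl t) = phase_state F t.+1.
Proof.
move=> XF lt; apply/funext => -[[[i b] y] l] /=; rewrite tpermK.
have [->|ne] := eqVneq i i0; last by rewrite !mul0r.
rewrite tpermL /xpos insubT /= XF bsgnD [in RHS](bigD1 (Ordinal lt)) //=.
rewrite [in RHS](eq_bigl (fun j : 'I_T => (j < t)%N)) => [|j]; first by ring.
by rewrite -val_eqE /= ltnS; case: ltngtP.
Qed.

(** State and transform both factor over the registers: the two single bits return to 1 and 0, and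
    each sample register carries the Fourier transform of [F]. *)
Lemma act_hadamard_phase F i b y l :
  act hadamard (phase_state F T) (i, b, y, l) =
  (i == i0)%:R * b%:R * (~~ l)%:R * \prod_j fhat R F (y j).
Proof.
transitivity ((\sum_k (i == k)%:R * (k == i0)%:R) * ((kap * kap) *
   ((\sum_d bsgn R (b && d) * bsgn R (true && d)) *
   ((\sum_(u : Y) chiT y u * \prod_j bsgn R (F (u j))) *
    (\sum_d bsgn R (l && d) * bsgn R (false && d)))))).
  rewrite /act sum_labels mulr_suml; apply: eq_bigr => k _.
  rewrite mulrA [in RHS]mulr_suml mulr_sumr; apply: eq_bigr => d _.
  rewrite mulr_suml !mulr_sumr; apply: eq_bigr => u _.
  rewrite !mulr_sumr; apply: eq_bigr => d' _; rewrite /hadamard /phase_state.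
  have -> : \prod_(j < T | (j < T)%N) bsgn R (F (u j)) = \prod_j bsgn R (F (u j)).
    by apply: eq_bigl => j; rewrite ltn_ord.
  by rewrite (_ : bsgn R (false && d') = 1) // andTb; ring.
have -> : \sum_k (i == k)%:R * (k == i0)%:R = (i == i0)%:R :> R.
  rewrite (bigD1 i) //= eqxx mul1r big1 ?addr0 // => k ne.
  by rewrite eq_sym (negPf ne) mul0r.
rewrite !sum_bsgn kap2.
have -> : \sum_(u : Y) chiT y u * \prod_j bsgn R (F (u j)) =
    (\prod_j fhat R F (y j)) * 2 ^+ (T * m).
  transitivity (\sum_(u : Y) \prod_j (bsgn R (F (u j)) * chi R (u j) (y j))).
    apply: eq_bigr => u _; rewrite /chiT -big_split; apply: eq_bigr => j _ /=.
    by rewrite mulrC chiC.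
  rewrite (sum_prod_samples (fun j x => bsgn R (F x) * chi R x (y j))).
  have -> : 2 ^+ (T * m) = \prod_(j < T) 2 ^+ m :> R.
    by rewrite prodr_const card_ord mulnC exprM.
  rewrite -big_split /=.
  apply: eq_bigr => j _; rewrite /fhat mulr_suml; apply: eq_bigr => x _.
  by rewrite mulfVK // expf_neq0 // pnatr_eq0.
rewrite eqb_id eqbF_neg; field.
by rewrite expf_neq0 // pnatr_eq0.
Qed.

Lemma foldl_mulmx n k (O : 'M[R[i]]_n) (U0 : 'M_n) (s : seq 'M_n) (v : 'M_(n, k)) :
  foldl (fun M U => U *m O *m M) U0 s *m v =
  foldl (fun v U => U *m (O *m v)) (U0 *m v) s.
Proof. by elim: s U0 => //= U s IH U0; rewrite IH !mulmxA. Qed.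

Lemma fourier_sampling : exists A : qalg R N T, forall (X : input N) v,
  prob_output A X v =
  \sum_(y | p y == v) \prod_j fhat R [ffun x => X (pos x)] (y j) ^+ 2.
Proof.
have [idx [[ib rm orc] [l0 zl]]] := ex_index.
(* [D t] follows the t-th phase: it addresses the next sample or, when t = T, applies the final
   transform and writes the answer. The operator [step t] first undoes [ctrl t]. *)
pose D t := if (t < T)%N then mxk idx (permk R (ctrl t))
  else mxk idx (permk R flag) *m mxk idx hadamard.
(* The transposition carries the zero label to [start] before the transform. *)
pose prep := mxk idx hadamard *m mxk idx (permk R (tperm l0 start)).
pose step t := D t.+1 *m mxk idx (permk R (ctrl t)).
have uH : mxk idx hadamard \is unitarymx by apply/mxk_unitary/hadamard_orthonormal.
have uP s : involutive s -> mxk idx (permk R s) \is unitarymx by apply: permk_unitary.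
have uD t : D t \is unitarymx.
  by rewrite /D; case: ifP => _; rewrite ?mul_unitarymx ?uH ?uP //; [apply: ctrlK|apply: flagK].
have uI : D 0%N *m prep \is unitarymx.
  by rewrite !mul_unitarymx ?uD ?uH ?uP //; apply: tpermK.
have uS (j : 'I_T) : tnth [tuple step t | t < T] j \is unitarymx.
  by rewrite tnth_mktuple mul_unitarymx ?uD ?uP //; apply: ctrlK.
exists (QAlg uI uS) => X v; set F := [ffun x => _].
have XF x : X (pos x) = F x by rewrite ffunE.
have oE : oracle R w X = mxk idx (permk R (query X)).
  by apply/matrixP => r c; rewrite !mxE orc rmorph_nat.
have z0 : zero_state R N w = colk idx (fun a => (a == l0)%:R).
  by apply/colP => k; rewrite !mxE zl rmorph_nat.
have init : D 0%N *m prep *m zero_state R N w = D 0%N *m colk idx (phase_state F 0).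
  rewrite -!mulmxA z0 !mxk_col // act_delta.
  rewrite (_ : (permk R (tperm l0 start))^~ l0 = fun a => (a == start)%:R); last first.
    by apply/funext => a; rewrite /permk tpermL.
  by rewrite act_delta (hadamard_start F).
have pc s u : involutive s -> mxk idx (permk R s) *m colk idx u = colk idx (u \o s).
  by move=> sK; rewrite mxk_col // act_permk.
have run t : (t <= T)%N ->
    foldl (fun v U => U *m (oracle R w X *m v)) (D 0%N *m prep *m zero_state R N w)
      (map step (iota 0 t)) = D t *m colk idx (phase_state F t).
  elim: t => [_|t IH lt]; first exact: init.
  have Dt : D t = mxk idx (permk R (ctrl t)) by rewrite /D lt.
  rewrite -[in iota _ _]addn1 iotaD map_cat foldl_cat IH ?(ltnW lt) // Dt oE add0n.
  rewrite [LHS]/= (pc _ _ (ctrlK t)) (pc _ _ (queryK X)) /step -mulmxA (pc _ _ (ctrlK t)).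
  by rewrite -(phase_stateS XF lt).
have fin : final_state (QAlg uI uS) X =
    colk idx (act hadamard (phase_state F T) \o flag).
  rewrite /final_state /qoperator foldl_mulmx /=.
  have -> : [seq step (val t) | t <- enum 'I_T] = map step (iota 0 T).
    by rewrite map_comp val_enum_ord.
  by rewrite run // /D ltnn -mulmxA mxk_col // pc //; apply: flagK.
transitivity (\sum_(a : L | a.2 == v) act hadamard (phase_state F T) (flag a) ^+ 2).
  rewrite /prob_output fin [RHS](reindex idx) /=; last exact: onW_bij.
  by apply: eq_big => [k|k _]; rewrite ?rm // normc_sqr mxE /= expr0n addr0.
rewrite big_mkcond sum_labels (bigD1 i0) //= [X in _ + X]big1 ?addr0; last first.
  move=> i ne; rewrite big1 // => b _; rewrite big1 // => y _; rewrite big1 // => l _.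
  by rewrite act_hadamard_phase (negPf ne) !mul0r expr0n /= if_same.
rewrite big_bool /= [X in _ + X]big1 ?addr0; last first.
  move=> y _; rewrite big1 // => l _.
  by rewrite act_hadamard_phase mulr0 !mul0r expr0n /= if_same.
rewrite [RHS]big_mkcond; apply: eq_bigr => y _; rewrite big_bool !act_hadamard_phase eqxx !mul1r.
rewrite prodrXl.
by case: (p y); case: v; rewrite /= ?mul1r ?mul0r ?expr0n ?addr0 ?add0r.
Qed.

End Algorithm.

(** * Hiding a period from few queries *)

Definition canon m (s x : bits m) : bits m :=
  if (enum_rank x <= enum_rank (bxor x s))%N then x else bxor x s.

Lemma canonP m (s x : bits m) : canon s x = x \/ canon s x = bxor x s.
Proof. by rewrite /canon; case: ifP; [left|right]. Qed.

Lemma canon_xor m (s x : bits m) : canon s (bxor x s) = canon s x.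
Proof.
rewrite /canon bxorK; case: ltngtP => // /val_inj/enum_rank_inj e.
exact: e.
Qed.

(** [F] ranges over all functions, although only its values at representatives matter; periodic and
    unrestricted instances are thus counted over the same set. *)
Definition periodize m (s : bits m) (F : {ffun bits m -> bool}) : {ffun bits m -> bool} :=
  [ffun x => F (canon s x)].

Section Collisions.
Variable m : nat.
Local Notation bfun := {ffun bits m -> bool}.
Variables (Q : bfun -> {set bits m}) (g : bfun -> bool).
Hypothesis loc : forall F F' : bfun, {in Q F, F =1 F'} -> Q F' = Q F /\ g F' = g F.

Definition collision_free (s : bits m) (F : bfun) : bool :=
  [forall x in Q F, bxor x s \notin Q F].

(* Exchanging the values of F on the pairs {x, x + s} whose noncanonical point
   is queried gives an injection F |-> F' such that the s-periodic function made
   from F' agrees with F on all queried positions. *)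
Lemma card_collision_free s v :
  (#|[set F | (g F == v) && collision_free s F]| <= #|[set F | g (periodize s F) == v]|)%N.
Proof.
pose tau F x := if bxor (canon s x) s \in Q F then bxor x s else x.
have tauK F : involutive (tau F).
  move=> x; have tc : canon s (tau F x) = canon s x.
    by rewrite /tau; case: ifP => _; rewrite ?canon_xor.
  by rewrite {1}/tau tc /tau; case: (_ \in Q F); rewrite ?bxorK.
pose ex (F : bfun) : bfun := [ffun x => F (tau F x)].
have agree F : collision_free s F -> {in Q F, F =1 periodize s (ex F)}.
  move=> /forallP cf x xQ; rewrite !ffunE /tau.
  have nx : bxor x s \notin Q F by apply: implyP (cf x) xQ.
  by case: (canonP s x) => e; rewrite !e ?canon_xor ?e ?bxorK ?xQ ?(negPf nx).
have exQ F : collision_free s F -> Q (periodize s (ex F)) = Q F /\ g (periodize s (ex F)) = g F.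
  by move=> /agree /loc.
rewrite -(card_in_imset (f := ex)) => [|F F']; last first.
  rewrite !inE => /andP[_ cf] /andP[_ cf'] e.
  (* The image [ex F] determines the query set, hence [tau F], hence [F]. *)
  have eQ : Q F = Q F' by have [<- _] := exQ _ cf; have [<- _] := exQ _ cf'; rewrite e.
  have et : tau F' = tau F by rewrite /tau eQ.
  apply/ffunP => x; have := congr1 (fun h : bfun => h (tau F x)) e.
  by rewrite !ffunE et tauK.
apply/subset_leq_card/fintype.subsetP => _ /imsetP[F + ->].
by rewrite !inE => /andP[/eqP gv /exQ[_ ->]]; rewrite gv.
Qed.

(** A string [s] with a collision is the sum of two queried points. *)
Lemma card_collisions (S : {set bits m}) F q : (#|Q F| <= q)%N ->
  (#|[set s in S | ~~ collision_free s F]| <= q * q)%N.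
Proof.
move=> cQ; apply: (@leq_trans #|[set bxor u.1 u.2 | u in setX (Q F) (Q F)]|).
  apply/subset_leq_card/fintype.subsetP => s; rewrite inE => /andP[_ /forallPn[x]].
  rewrite negb_imply negbK => /andP[xQ xsQ]; apply/imsetP; exists (bxor x s, x).
    by rewrite inE xsQ xQ.
  by rewrite /= (bxorC x s) bxorK.
by rewrite (leq_trans (leq_imset_card _ _)) // cardsX leq_mul.
Qed.

(** Collision-free pairs (s, F) are handled by the injection; the remaining ones are counted for
    each F, which has at most q^2 colliding s. *)
Lemma sum_card_periodize (S : {set bits m}) q v : (forall F, #|Q F| <= q)%N ->
  (#|S| * #|[set F | g F == v]| <=
   \sum_(s in S) #|[set F | g (periodize s F) == v]| + q * q * #|{: bfun}|)%N.
Proof.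
move=> cQ.
apply: (@leq_trans (\sum_(s in S) (#|[set F | (g F == v) && collision_free s F]|
    + #|[set F | ~~ collision_free s F]|))).
  rewrite -sum_nat_const; apply: leq_sum => s _.
  rewrite -cardsUI (leq_trans _ (leq_addr _ _)) //.
  apply/subset_leq_card/fintype.subsetP => F; rewrite !inE => ->.
  by case: collision_free.
rewrite big_split leq_add //=; first by apply: leq_sum => s _; apply: card_collision_free.
under eq_bigr => s _ do rewrite -sum1_card.
rewrite (exchange_big_dep predT) //= mulnC -sum_nat_const; apply: leq_sum => F _.
rewrite sum1_card; apply: leq_trans (card_collisions S (cQ F)).
by apply/subset_leq_card/fintype.subsetP => s; rewrite unfold_in !inE.
Qed.

End Collisions.

(** * The hard distribution *)

Lemma sum_dom_eq (R : realFieldType) (X : finType) (D : {set X}) (P : pred X) u : u \in D ->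
  \sum_(x : {x | x \in D} | P (val x)) (u == val x)%:R = (P u)%:R :> R.
Proof.
move=> uD; rewrite big_mkcond (bigD1 (exist _ u uD)) //= eqxx big1 ?addr0 => [|x ne].
  by case: (P u).
case: ifP => // _; rewrite (_ : _ == _ = false) //.
by apply: contraNF ne => /eqP e; apply/eqP/val_inj.
Qed.

Lemma ex_subset_card (X : finType) (A : {set X}) k : (k <= #|A|)%N ->
  exists2 S : {set X}, S \subset A & #|S| = k.
Proof.
move=> kA; exists [set x in take k (enum A)].
  by apply/fintype.subsetP => x; rewrite inE => /mem_take; rewrite mem_enum.
rewrite cardsE (card_uniqP _) ?take_uniq ?enum_uniq // size_take -cardE.
by case: ltngtP kA.
Qed.

Lemma natr_card_set (R : nzSemiRingType) (X : finType) (b : pred X) :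
  #|[set x | b x]|%:R = \sum_x (b x)%:R :> R.
Proof.
rewrite -sum1_card natr_sum big_mkcond; apply: eq_bigr => x _.
by rewrite inE; case: (b x).
Qed.

(** Here s is the number of periods, M that of functions, a of rejected F, b of bad F, u bounds the
    successes on the [no] side, and y counts rejected periodic pairs. The success probability is at
    most 1/2 + 1/32 + 3/64 = 37/64 < 2/3. *)
Lemma success_lt (R : realFieldType) (s M a b u y q : R) :
  0 < s -> 0 < M -> u <= a + b -> b <= 3 / 32 * M -> q <= s / 16 ->
  s * a <= y + q * M -> 2 / 3 <= (s * M - y) / (s * M) / 2 + u / M / 2 -> False.
Proof.
move=> s0 M0 hu hb hq hy.
have -> : (s * M - y) / (s * M) / 2 + u / M / 2 = (s * M - y + s * u) / (2 * (s * M)).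
  by field; rewrite !gt_eqF.
have sM : 0 < s * M by rewrite mulr_gt0.
rewrite ler_pdivlMr ?mulr_gt0 // => H.
have h1 : s * u <= s * (a + b) by rewrite ler_pM2l.
have h2 : s * b <= s * (3 / 32 * M) by rewrite ler_pM2l.
have h3 : q * M <= s / 16 * M by rewrite ler_pM2r.
nra.
Qed.

Section Hard.
Variables (R : realType) (n N : nat).
(* The nine extra bits keep the union bound #|S| * 8 / 2 ^ m small. *)
Local Notation m := (n + 9)%N.
Local Notation T := (5 * m)%N.
Local Notation bfun := {ffun bits m -> bool}.
Variables (pos : bits m -> 'I_N) (S : {set bits m}).
Hypothesis pos_inj : injective pos.
Hypothesis S0 : bzero m \notin S.
Hypothesis cardS : #|S| = (2 ^ n)%N.

Definition accepts (y : {ffun 'I_T -> bits m}) : bool :=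
  [exists s in S, forall j, ~~ bdot s (y j)].

Definition emb (F : bfun) : input N := [ffun i => [exists x, (pos x == i) && F x]].

Lemma embE F x : emb F (pos x) = F x.
Proof.
rewrite ffunE; apply/existsP/idP => [[z /andP[/eqP/pos_inj->]] //|Fx].
by exists x; rewrite eqxx.
Qed.

Lemma ffun_embE F : [ffun x => emb F (pos x)] = F.
Proof. by apply/ffunP => x; rewrite ffunE embE. Qed.

Definition sample_prob (F : bfun) (v : bool) : R :=
  \sum_(y : {ffun 'I_T -> bits m} | accepts y == v) \prod_j fhat R F (y j) ^+ 2.

Lemma sample_probC F : sample_prob F true + sample_prob F false = 1.
Proof.
transitivity (\sum_(y : {ffun 'I_T -> bits m}) \prod_j fhat R F (y j) ^+ 2).
  rewrite [RHS](bigID accepts) /=; congr (_ + _); apply: eq_bigl => y.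
    by rewrite eqb_id.
  by rewrite eqbF_neg.
rewrite -(bigA_distr_bigA (fun j x => fhat R F x ^+ 2)) big1 // => j _.
exact: sum_fhat2.
Qed.

Lemma sample_prob_ge0 F v : 0 <= sample_prob F v.
Proof. by apply: sumr_ge0 => y _; apply: prodr_ge0 => j _; apply: sqr_ge0. Qed.

(** A rejected tuple contains a sample not orthogonal to [s], where the Fourier coefficient
    vanishes. *)
Lemma sample_prob_periodic s F : s \in S -> sample_prob (periodize s F) true = 1.
Proof.
move=> sS; rewrite -(sample_probC (periodize s F)) [X in _ = _ + X]big1 ?addr0 // => y.
rewrite eqbF_neg => /existsPn/(_ s); rewrite sS /= => /forallPn[j].
rewrite negbK => dot; rewrite (bigD1 j) //= (@fhat_periodic R _ _ s _ _ dot) ?expr0n ?mul0r // => x.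
by rewrite !ffunE canon_xor.
Qed.

Lemma weight_ge0 (F : bfun) s : 0 <= weight R F s.
Proof. by apply: sumr_ge0 => y _; apply: sqr_ge0. Qed.

(** Union bound over the candidate periods, with T independent samples for each. *)
Lemma sample_prob_le F : sample_prob F true <= \sum_(s in S) weight R F s ^+ T.
Proof.
have wE s : weight R F s ^+ T =
    \sum_(y : {ffun 'I_T -> bits m} | [forall j, ~~ bdot s (y j)]) \prod_j fhat R F (y j) ^+ 2.
  rewrite -[X in _ ^+ X](card_ord T) -prodr_const.
  under eq_bigr => j _ do rewrite /weight big_mkcond.
  rewrite bigA_distr_bigA [RHS]big_mkcond; apply: eq_bigr => y _.
  have [/forallP al|/forallPn[j /negPf nj]] := boolP [forall j, ~~ bdot s (y j)].
    by apply: eq_bigr => j _; rewrite al.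
  by rewrite (bigD1 j) //= nj mul0r.
under eq_bigr => s _ do rewrite wE.
rewrite (exchange_big_dep predT) //= /sample_prob big_mkcond; apply: ler_sum => y _.
have P0 : 0 <= \prod_j fhat R F (y j) ^+ 2 by apply: prodr_ge0 => j _; apply: sqr_ge0.
rewrite eqb_id; case: ifP => [/existsP[s acc]|_]; last exact: sumr_ge0.
by rewrite (bigD1 s) //= lerDl; apply: sumr_ge0.
Qed.

(* The second summand is at least 1 unless autocorr <= 1/2, as in Chebyshev's
   inequality. *)
Lemma weight_exp_le (F : bfun) s : weight R F s ^+ T <= (3 / 4) ^+ T + 4 * autocorr R F s ^+ 2.
Proof.
have /andP[a1 a2] := norm_autocorr_le1 R F s; have w0 := weight_ge0 F s.
have e := weightE R F s; have a0 : 0 <= autocorr R F s ^+ 2 by apply: sqr_ge0.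
have t0 : 0 <= (3 / 4) ^+ T :> R by apply: exprn_ge0; lra.
have [le|lt] := leP (autocorr R F s) (1 / 2).
  have : weight R F s ^+ T <= (3 / 4) ^+ T by apply: lerXn2r; rewrite ?nnegrE; lra.
  lra.
have : weight R F s ^+ T <= 1 by apply: exprn_ile1; lra.
have : 1 / 4 <= autocorr R F s ^+ 2 by rewrite expr2; nra.
lra.
Qed.

(** The factor 5 in T is chosen because (3/4)^5 <= 1/4, so (3/4)^T <= 4^(-m). *)
Lemma exp34_le : 2 ^+ n * (3 / 4) ^+ T <= 1 / 64 :> R.
Proof.
have q : (3 / 4) ^+ 5 <= 1 / 4 :> R by lra.
have h0 : 0 <= (3 / 4) ^+ 5 :> R by apply: exprn_ge0; lra.
apply: (@le_trans _ _ (2 ^+ n * (1 / 4) ^+ m)).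
  by rewrite ler_wpM2l ?exprn_ge0 // exprM lerXn2r // nnegrE; lra.
rewrite exprD mulrA -exprMn.
have -> : 2 * (1 / 4) = 1 / 2 :> R by field.
have : (1 / 2) ^+ n <= 1 :> R by apply: exprn_ile1; lra.
have : 0 <= (1 / 2) ^+ n :> R by apply: exprn_ge0; lra.
have : (1 / 4) ^+ 9 <= 1 / 64 :> R by lra.
have : 0 <= (1 / 4) ^+ 9 :> R by apply: exprn_ge0; lra.
move: ((1 / 2) ^+ n) ((1 / 4) ^+ 9) => a b *; nra.
Qed.

Lemma sum_sample_prob_le : \sum_F sample_prob F true <= 1 / 32 * #|{: bfun}|%:R.
Proof.
have M0 : 0 <= #|{: bfun}|%:R :> R by [].
apply: (@le_trans _ _ (\sum_(F : bfun) \sum_(s in S) ((3 / 4) ^+ T + 4 * autocorr R F s ^+ 2))).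
  apply: ler_sum => F _; apply: le_trans (sample_prob_le F) _.
  by apply: ler_sum => s _; apply: weight_exp_le.
rewrite exchange_big /= (eq_bigr (fun=> ((3 / 4) ^+ T + 8 / 2 ^+ m) * #|{: bfun}|%:R)) => [|s sS].
  rewrite sumr_const cardS -[X in X <= _]mulr_natl natrX mulrA mulrDr.
  apply: ler_wpM2r => //; have := exp34_le.
  have -> : 2 ^+ n * (8 / 2 ^+ m) = 1 / 64 :> R.
    rewrite exprD; have : 2 ^+ n != 0 :> R by rewrite expf_neq0 // pnatr_eq0.
    by move: (2 ^+ n) => a a0; field.
  lra.
have s0 : s != bzero m by apply: contraNneq S0 => <-.
rewrite big_split /= -mulr_sumr sum_autocorr2 // sumr_const -[(_ ^+ _) *+ _]mulr_natr.
by ring.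
Qed.

(** Markov's inequality at the threshold 1/3, applied to the mean bound 1/32. *)
Lemma card_bad_le :
  #|[set F : bfun | 1 / 3 < sample_prob F true]|%:R <= 3 / 32 * #|{: bfun}|%:R :> R.
Proof.
have H := sum_sample_prob_le.
have : 1 / 3 * #|[set F : bfun | 1 / 3 < sample_prob F true]|%:R <=
    \sum_F sample_prob F true :> R.
  rewrite mulr_natr -sumr_const big_mkcond; apply: ler_sum => F _.
  by rewrite inE; case: ifP => [/ltW|_] //; apply: sample_prob_ge0.
lra.
Qed.

Lemma hard_instance (i0 : 'I_N) : i0 = 0%N :> nat ->
  exists (D : {set input N}) (f : dom D -> bool) (mu : dom D -> R),
  [/\ is_distribution mu, exists A : qalg R N T, bounded_error f A &
      forall T' (A : qalg R N T'), strongly_exact f mu A -> (2 ^ n <= (4 * T') ^ 8)%N].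
Proof.
move=> i00; have [A0 A0E] := fourier_sampling R pos i00 accepts.
have embP F v : prob_output A0 (emb F) v = sample_prob F v.
  by rewrite A0E ffun_embE.
pose M := #|{: bfun}|%:R : R.
have M0 : 0 < M by rewrite ltr0n; apply/card_gt0P; exists [ffun=> false].
(* Not every function is bad; [F0] replaces the bad ones, so that [no] always lands in [D]. *)
have [F0 good0] : exists F0, sample_prob F0 true <= 1 / 3.
  have [/existsP[F0 H]|/existsPn H] := boolP [exists F0, sample_prob F0 true <= 1 / 3].
    by exists F0.
  have := card_bad_le; rewrite (_ : [set F | _] = setT) ?cardsT; first by rewrite -/M; lra.
  by apply/setP => F; rewrite !inE ltNge H.
(* The domain collects the inputs on which the sampling algorithm favours one answer with
   probability at least 2/3; [f] is that answer. *)
pose D : {set input N} :=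
  [set X | (2 / 3 <= prob_output A0 X true) || (2 / 3 <= prob_output A0 X false)].
pose dec X : bool := 2 / 3 <= prob_output A0 X true.
pose f (x : dom D) := dec (val x).
pose yes (u : bits m * bfun) := emb (periodize u.1 u.2).
pose no (F : bfun) := if sample_prob F true <= 1 / 3 then emb F else emb F0.
have yes1 s F : s \in S -> prob_output A0 (yes (s, F)) true = 1.
  by move=> sS; rewrite embP sample_prob_periodic.
have yesD s F : s \in S -> yes (s, F) \in D.
  by move=> sS; rewrite inE yes1 //; apply/orP; left; lra.
have no1 F : prob_output A0 (no F) true <= 1 / 3.
  by rewrite /no; case: ifP => h; rewrite embP ?h.
have noD F : no F \in D.
  rewrite inE; apply/orP; right; have := no1 F.
  rewrite /no; case: ifP => _; rewrite !embP; [have := sample_probC F|have := sample_probC F0];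
  lra.
pose k : R := #|S|%:R * M.
have k0 : 0 < k by rewrite mulr_gt0 // ltr0n cardS expn_gt0.
(* Half of the mass is the image of uniform pairs (s, F) under [yes], half the image of uniform F
   under [no]. *)
pose mu (x : dom D) : R :=
  (\sum_(s in S) \sum_F (yes (s, F) == val x)%:R) / k / 2 + (\sum_F (no F == val x)%:R) / M / 2.
have sum_mu (P : pred (input N)) : \sum_(x : dom D | P (val x)) mu x =
    (\sum_(s in S) \sum_F (P (yes (s, F)))%:R) / k / 2 + (\sum_F (P (no F))%:R) / M / 2.
  rewrite big_split /= -!mulr_suml; congr (_ / _ / _ + _ / _ / _).
    rewrite exchange_big; apply: eq_bigr => s sS; rewrite exchange_big; apply: eq_bigr => F _.
    by rewrite sum_dom_eq // yesD.
  by rewrite exchange_big; apply: eq_bigr => F _; rewrite sum_dom_eq.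
exists D, f, mu; split.
- split=> [x|].
    by rewrite addr_ge0 // !divr_ge0 ?(ltW k0) ?(ltW M0) // !sumr_ge0 // => s _; rewrite sumr_ge0.
  rewrite (eq_bigl (fun x : dom D => predT (val x))) // sum_mu.
  rewrite /= !sumr_const -/M -[M *+ _]mulr_natl -/k !divff ?gt_eqF //; lra.
- exists A0 => x; have := valP x; rewrite inE /f /dec.
  by case E: (2 / 3 <= prob_output A0 (val x) true).
move=> T' A [succ exact01].
pose h X := accept_prob A X == 1.
have hE X : (h X)%:R = accept_prob A X.
  by rewrite /h; case: (exact01 X) => ->; rewrite ?eqxx // eq_sym oner_eq0.
(* The degree is 2T', so at most 4 (2T')^4 = 64 T'^4 positions are read. *)
have [Q [cQ loc]] := query_set (deg_ext (fun X => esym (hE X)) (deg_accept_prob A)).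
pose QF (F : bfun) : {set bits m} := [set x | pos x \in Q (emb F)].
pose g (F : bfun) := h (emb F).
have cQF F : (#|QF F| <= 64 * T' ^ 4)%N.
  apply: leq_trans (_ : #|Q (emb F)| <= _)%N.
    rewrite -(card_imset _ pos_inj); apply/subset_leq_card/fintype.subsetP => i.
    by move=> /imsetP[x + ->]; rewrite inE.
  by rewrite (leq_trans (cQ _)) // addnn -mul2n expnMn mulnA.
have locF (F F' : bfun) : {in QF F, F =1 F'} -> QF F' = QF F /\ g F' = g F.
  move=> FF'; have [] := loc (emb F) (emb F').
    move=> i iQ; rewrite !ffunE; apply: eq_existsb => x.
    by have [e|//] := eqVneq (pos x) i; rewrite FF' // inE e.
  by move=> eQ eh; split; [apply/setP => x; rewrite !inE eQ|].
have key := sum_card_periodize locF S false cQF.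
have e : \sum_(x : dom D | accept_prob A (val x) == (f x)%:R) mu x = _ :=
  sum_mu (fun X => accept_prob A X == (dec X)%:R).
rewrite {}e in succ.
have yesE : \sum_(s in S) \sum_F (accept_prob A (yes (s, F)) == (dec (yes (s, F)))%:R)%:R
    = k - (\sum_(s in S) #|[set F | g (periodize s F) == false]|)%:R :> R.
  rewrite natr_sum /k mulr_natl -sumr_const -sumrB; apply: eq_bigr => s sS.
  apply/eqP; rewrite eq_sym subr_eq; apply/eqP; rewrite natr_card_set -big_split /=.
  rewrite /M -sumr_const; apply: eq_bigr => F _; rewrite /dec yes1 //.
  have -> : (2 / 3 <= 1 :> R) = true by apply/idP; lra.
  rewrite -[accept_prob A _ == _]/(g (periodize s F)).
  by case: (g _); rewrite ?addr0 ?add0r.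
(* Bad functions, whose instance was replaced, are conceded as successes. *)
have noE : \sum_F (accept_prob A (no F) == (dec (no F))%:R)%:R
    <= #|[set F | g F == false]|%:R + #|[set F : bfun | 1 / 3 < sample_prob F true]|%:R :> R.
  rewrite !natr_card_set -big_split; apply: ler_sum => F _ /=.
  have -> : dec (no F) = false.
    by apply/negbTE; rewrite /dec -ltNge; have := no1 F; lra.
  rewrite /no; case: leP => _.
    2: by rewrite -natrD ler_nat; case: (_ == _); case: (g F).
  rewrite addr0 /g -hE; case: (h _); by rewrite ?oner_eq0 ?eqxx.
have bad := card_bad_le; rewrite -/M in bad.
rewrite leqNgt; apply/negP => small.
have Sgt0 : 0 < #|S|%:R :> R by rewrite ltr0n cardS expn_gt0.
(* (64 T'^4)^2 is exactly (4T')^8 / 16. *)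
have small' : (64 * T' ^ 4 * (64 * T' ^ 4))%:R <= #|S|%:R / 16 :> R.
  rewrite ler_pdivlMr // -natrM ler_nat cardS; apply: leq_trans (ltnW small).
  by rewrite expnMn -[8%N]/(4 + 4)%N expnD; apply: eq_leq; ring.
rewrite yesE in succ; move: key; rewrite -(ler_nat R) natrD natrM [in X in _ + X]natrM -/M => key.
exact: (success_lt Sgt0 M0 noE bad small' key succ).
Qed.

End Hard.

(** * Instances of length n * 2^n and the asymptotic bounds *)

Lemma instance_at (R : realType) n :
  exists (D : {set input (n * 2 ^ n)}) (f : dom D -> bool) (mu : dom D -> R),
  ((1 <= n)%N -> is_distribution mu) /\ ((512 <= n)%N ->
   (exists A : qalg R (n * 2 ^ n) (5 * (n + 9)), bounded_error f A) /\
   forall T (A : qalg R (n * 2 ^ n) T), strongly_exact f mu A -> (2 ^ n <= (4 * T) ^ 8)%N).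
Proof.
(* The 2^(n+9) = 512 * 2^n values fit into n * 2^n positions once n >= 512. Below that only a
   distribution is required, and a point mass is used. *)
have [n0|large] := ltnP n 512.
  exists finset.setT, (fun=> false), (fun x => (val x == [ffun=> false])%:R); split => [_|//].
  split => [x //|].
  have := sum_dom_eq R predT (finset.in_setT ([ffun=> false] : input (n * 2 ^ n))).
  by move=> s1; apply: etrans s1; apply: eq_bigr => x _; rewrite eq_sym.
have card_bits : #|{: bits (n + 9)}| = (2 ^ (n + 9))%N.
  by rewrite card_ffun card_bool card_ord.
have le : (#|{: bits (n + 9)}| <= n * 2 ^ n)%N.
  by rewrite card_bits expnD mulnC leq_mul2r large orbT.
have [S SA cS] : exists2 S : {set bits (n + 9)}, S \subset ~: [set bzero _] & #|S| = (2 ^ n)%N.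
  apply: ex_subset_card; rewrite cardsC1 card_bits expnD.
  rewrite (_ : 2 ^ 9 = 512)%N //; have : (0 < 2 ^ n)%N by rewrite expn_gt0.
  by move: (2 ^ n)%N => k; lia.
have S0 : bzero _ \notin S.
  by apply/negP => /(fintype.subsetP SA); rewrite !inE eqxx.
have posI : injective (fun x : bits (n + 9) => widen_ord le (enum_rank x)).
  by move=> x y /(congr1 val) /= /val_inj/enum_rank_inj.
have N0 : (0 < n * 2 ^ n)%N by rewrite muln_gt0 expn_gt0 andbT; apply: leq_trans large.
have [D [f [mu [dist bound lower]]]] := @hard_instance R n _ _ _ posI S0 cS (Ordinal N0) erefl.
by exists D, f, mu.
Qed.

Lemma instances (R : realType) :
  exists (D : forall n : nat, {set input (n * 2 ^ n)})
         (f : forall n : nat, dom (D n) -> bool)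
         (mu : forall n : nat, dom (D n) -> R),
  forall n, ((1 <= n)%N -> is_distribution (mu n)) /\ ((512 <= n)%N ->
   (exists A : qalg R (n * 2 ^ n) (5 * (n + 9)), bounded_error (f n) A) /\
   forall T (A : qalg R (n * 2 ^ n) T),
     strongly_exact (f n) (mu n) A -> (2 ^ n <= (4 * T) ^ 8)%N).
Proof.
pose H1 n := svalP (cid (instance_at R n)).
pose H2 n := svalP (cid (H1 n)).
exists (fun n => sval (cid (instance_at R n))), (fun n => sval (cid (H1 n))),
  (fun n => sval (cid (H2 n))).
by move=> n; exact: (svalP (cid (H2 n))).
Qed.

Lemma eighth_root_le (R : realType) n T : (2 ^ n <= (4 * T) ^ 8)%N ->
  1 / 4 * 2 `^ (n%:R / 8) <= T%:R :> R.
Proof.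
rewrite -(ler_nat R) !natrX => le8.
have : 2 `^ (n%:R / 8) <= (4 * T)%N%:R :> R.
  rewrite -(@ler_pXn2r _ 8) ?nnegrE ?powR_ge0 //.
  apply: le_trans le8; rewrite -powR_mulrn ?powR_ge0 // -powRrM divfK ?pnatr_eq0 //.
  by rewrite powR_mulrn.
rewrite natrM => le4.
by rewrite mul1r mulrC ler_pdivrMr // [T%:R * _]mulrC.
Qed.

Local Open Scope classical_set_scope.

Theorem theorem2 (R : realType) :
  exists (D : forall n : nat, {set input (n * 2 ^ n)})
         (f : forall n : nat, dom (D n) -> bool)
         (mu : forall n : nat, dom (D n) -> R),
    [/\ (forall n : nat, (1 <= n)%N -> is_distribution (mu n)),
        (exists2 c : R, 0 < c &
           \forall n \near \oo, (Q2 R (f n) <= (c * n%:R ^+ 2)%:E)%E)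
      & (exists2 c : R, 0 < c &
           \forall n \near \oo,
             ((c * 2 `^ (n%:R / 8))%:E <= QSE (f n) (mu n))%E)].
Proof.
have [D [f [mu H]]] := instances R; exists D, f, mu; split.
- by move=> n n0; apply: (proj1 (H n)).
- exists 10 => //; exists 512%N => // n /= large.
  have [qA _] := proj2 (H n) large.
  (* The sampling algorithm uses 5 (n + 9) queries, which is linear in n and below 10 n^2. *)
  apply: (@le_trans _ _ (((5 * (n + 9))%N%:R : R)%:E)).
    by apply: ereal_inf_lbound; exists (5 * (n + 9))%N.
  rewrite lee_fin -natrX -[10]/(10%N%:R) -natrM ler_nat.
  by move: large; clear; nia.
- exists (1 / 4); first by rewrite divr_gt0.
  exists 512%N => // n /= large.
  have [_ lower] := proj2 (H n) large.
  apply: le_ereal_inf_tmp => _ [T [A succ] <-]; rewrite lee_fin.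
  exact: eighth_root_le (lower T A succ).
Qed.
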